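(* Let $\Bbbk$ be a field with $\operatorname{char}\Bbbk\neq 2$, $n\ge 1$, $H=E(n)$, and let $A=Cl(\alpha,\beta_i,\gamma_i,\lambda_{ij})$ be a Clifford algebra endowed with its canonical $H$-coaction. The cowreath $(A\otimes H^{op},H,\psi)$ is rt-separable if, and only if, one of the following holds: (1) $A=Cl(0,0,0,0)$, i.e. $\alpha=0$, $\beta_i=\gamma_i=0$ for all $i$ and $\lambda_{ij}=0$ for all $i<j$; or (2) $A=Cl\left(\alpha,\frac{\gamma_i^2}{4\alpha},\gamma_i,\frac{\gamma_i\gamma_j}{2\alpha}\right)$ with $\alpha\neq 0$, i.e. $\alpha\ne0$, $\beta_i=\frac{\gamma_i^2}{4\alpha}$ for all $i$ and $\lambda_{ij}=\frac{\gamma_i\gamma_j}{2\alpha}$ for all $i<j$. In these cases the Casimir elements $B(h\otimes h')=B^A(h\otimes h')\otimes 1_H$ realizing rt-separability are those for which $B^A$ is given by $$B^A(g^jx_P\otimes g^kx_Q)=B^A(1\otimes S(g^jx_P)g^kx_Q),\qquad B^A(1_H\otimes 1_H)=1_A,$$ $$B^A(1\otimes x_Q)=\sum_{R\subseteq\overline Q,\ |R|\equiv |Q|\ (\mathrm{mod}\ 2)}(-1)^{S(Q\setminus R,Q)}\,\eta_{Q\setminus R}\,X_R,$$ $$B^A(1\otimes gx_Q)=\frac{\mu}{2^{\lfloor |\overline Q|/2\rfloor}}\sum_{R\subseteq\overline Q,\ |R|\equiv|\overline Q|\ (\mathrm{mod}\ 2)}(-1)^{S(R,\overline Q)+\frac{|\overline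 Q|-|R|}{2}}\,2^{\lfloor |R|/2\rfloor}\sum_{\mathcal P\in\pi_2(\overline Q\setminus R)}\operatorname{sgn}(\mathcal P)\,\Lambda(\mathcal P)\,X_R,$$ for $j,k\in\{0,1\}$ and all $P,Q\subseteq\{1,\dots,n\}$, where $\overline Q=Q\sqcup\{0\}$, $\mu\in\Bbbk$ and $\eta_T\in\Bbbk$ for every $T\subseteq\{1,\dots,n\}$, and where, if $\alpha\neq0$, for every $T\subseteq \{1,\dots,n\}$ with $|T|$ odd $$\eta_T=\sum_{i\in T}(-1)^{S(\{i\},T)+1}\,\eta_{T\setminus\{i\}}\,\frac{\gamma_i}{2\alpha}.$$
   Context: **$E(n)$.** $E(n)$ is the $2^{n+1}$-dimensional Hopf $\Bbbk$-algebra generated by $g,x_1,\dots,x_n$ with $g^2=1$, $x_i^2=0$, $gx_i=-x_ig$, $x_ix_j=-x_jx_i$ for $i<j$; $\Delta(g)=g\otimes g$, $\varepsilon(g)=1$, antipode $S(g)=g$, $\Delta(x_i)=x_i\otimes g+1\otimes x_i$, $\varepsilon(x_i)=0$, $S(x_i)=gx_i$. For $P=\{i_1<\dots<i_s\}\subseteq\{1,\dots,n\}$, $x_P=x_{i_1}\cdots x_{i_s}$, $x_\emptyset=1$; the $g^jx_P$ ($j=0,1$) form a basis. **The function $S(F,P)$** (distinguished from the antipode by its arguments). For finite sets of integers $F\subseteq P=\{i_1<\dots<i_s\}$ with $F=\{i_{j_1},\dots,i_{j_r}\}$, $S(F,P)=(j_1+\dots+j_r)-\frac{r(r+1)}2$,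 and $S(\emptyset,P)=0$. **Clifford algebras.** Given $\alpha,\beta_i,\gamma_i\in\Bbbk$ ($1\le i\le n$) and $\lambda_{ij}\in\Bbbk$ ($1\le i<j\le n$), $Cl(\alpha,\beta_i,\gamma_i,\lambda_{ij})$ is the unital associative algebra generated by $G,X_1,\dots,X_n$ with $G^2=\alpha$, $X_i^2=\beta_i$, $GX_i+X_iG=\gamma_i$, $X_iX_j+X_jX_i=\lambda_{ij}$ ($i<j$). Put $X_0=G$, $\lambda_{0i}=\gamma_i$. For $R=\{i_1<\dots<i_s\}\subseteq\{0,1,\dots,n\}$, $X_R=X_{i_1}\cdots X_{i_s}$, $X_\emptyset=1$; the $X_R$ form a basis. The canonical $E(n)$-coaction is the right comodule algebra structure $\rho:A\to A\otimes E(n)$ with $\rho(1)=1\otimes1$, $\rho(G)=G\otimes g$, $\rho(X_i)=X_i\otimes g+1\otimes x_i$. **Cowreath and rt-separability.** For a Hopf algebra $H$ and a right $H$-comodule algebra $A$ (Sweedler notation $\rho(a)=a_0\otimes a_1$, $\Delta(h)=h_1\otimes h_2$), the cowreath $(A\otimes H^{op},H,\psi)$ has $\psi:H\otimes A\otimes H^{op}\to A\otimes H^{op}\otimes H$, $\psi(h\otimes a\otimes l)=a_0\otimes l_1\otimes l_2ha_1$, with comultiplication $h\mapsto 1_A\otimes1_H\otimes h_1\otimes h_2$ and counit $h\mapsto\varepsilon(h)1_A\otimes 1_H$. It is called rt-separable (right-trivially separable) if there is a linear map $B:H\otimes H\to A\otimes H^{op}$ (the Casimir element) of the form $B(h\otimes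 h')=B^A(h\otimes h')\otimes1_H$, with $B^A:H\otimes H\to A$ linear, such that for all $a\in A$, $h,h',h''\in H$: (i) $a_0B^A(ha_1\otimes h'a_2)=B^A(h\otimes h')a$; (ii) $B^A(1\otimes h)_0\otimes B^A(1\otimes h)_1=B^A(1\otimes h_1)\otimes h_2$; (iii) $B^A(h_1h'\otimes h_2h'')=\varepsilon(h)B^A(h'\otimes h'')$ and $B^A(1_H\otimes1_H)=1_A$. **Perfect matchings.** For a finite set $U$ of integers with $|U|=2m$ even, $\pi_2(U)$ is the set of partitions of $U$ into $2$-element blocks ($\pi_2(\emptyset)=\{\emptyset\}$). Write $\mathcal P=P_1|\cdots|P_m$ with $P_k=\{s_{k_1}<s_{k_2}\}$ and $s_{1_2}<s_{2_2}<\dots<s_{m_2}$. If $U=\{s_1<\dots<s_{2m}\}$, $\operatorname{sgn}(\mathcal P)$ is the sign of the permutation of $U$ sending $s_{2k-1}\mapsto s_{k_1}$, $s_{2k}\mapsto s_{k_2}$; $\operatorname{sgn}(\emptyset)=1$. For $U\subseteq\{0,\dots,n\}$ put $\Lambda(\mathcal P)=\prod_{k=1}^m\lambda_{s_{k_1}s_{k_2}}$, $\Lambda(\emptyset)=1$. *)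

(* Defs.v *)
From mathcomp Require Import all_boot all_order all_fingroup all_algebra all_field.

Set Implicit Arguments.
Unset Strict Implicit.
Unset Printing Implicit Defensive.
Import GRing.Theory.
Local Open Scope ring_scope.

(* Coordinate model, in the library's bases [vbasis {:U}] and [vbasis {:V}], of
   the tensor product of two finite-dimensional spaces: u ⊗ v is the matrix of
   products of coordinates.  It is canonically a vectType, so tensor products
   can be iterated. *)
Definition tens (k : fieldType) (U V : vectType k) : vectType k :=
  'M[k]_(\dim {:U}, \dim {:V}).

Definition tprod (k : fieldType) (U V : vectType k) (u : U) (v : V) : tens U V :=
  \matrix_(i, j) (coord (vbasis {:U}) i u * coord (vbasis {:V}) j v).

Notation "u ⊗ v" := (tprod u v) (at level 40, left associativity) : ring_scope.

(* The linear map U ⊗ V -> W induced by a bilinear f: see [tliftE] and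
   [tlift_linear].  With t = \sum t_1 ⊗ t_2, [tlift (fun a b => f a b) t]
   is Sweedler's f(t_1, t_2). *)
Definition tlift (k : fieldType) (U V W : vectType k) (f : U -> V -> W)
    (t : tens U V) : W :=
  \sum_i \sum_j t i j *: f (vbasis {:U})`_i (vbasis {:V})`_j.

Lemma tlift_linear (k : fieldType) (U V W : vectType k) (f : U -> V -> W) :
  linear (tlift f).
Proof.
move=> a s t; rewrite /tlift scaler_sumr -big_split /=; apply: eq_bigr => i _.
rewrite scaler_sumr -big_split /=; apply: eq_bigr => j _.
by rewrite !mxE scalerDl scalerA.
Qed.

Lemma tliftE (k : fieldType) (U V W : vectType k) (f : U -> V -> W) :
  (forall u, linear (f u)) -> (forall v, linear (f^~ v)) ->
  forall u v, tlift f (u ⊗ v) = f u v.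
Proof.
move=> fr fl u v.
have sumr (S : vectType k) (g : S -> W) : linear g -> forall w : S,
    g w = \sum_i coord (vbasis {:S}) i w *: g (vbasis {:S})`_i.
  move=> glin w.
  have g0 : g 0 = 0 by have := glin (-1) 0 0; rewrite !scaleN1r oppr0 add0r addNr.
  rewrite {1}(coord_vbasis (memvf w)).
  apply: (big_ind2 (fun y z => g y = z)) => // [x1 x2 y1 y2 <- <-|i _].
    by rewrite -[x1 in LHS]scale1r glin scale1r.
  by rewrite -[X in g X]addr0 glin g0 addr0.
rewrite /tlift [RHS](sumr U (f^~ v)) //; apply: eq_bigr => i _.
rewrite [in RHS](sumr V (f _)) // scaler_sumr; apply: eq_bigr => j _.
by rewrite scalerA !mxE.
Qed.

Definition tmul (k : fieldType) (A B : falgType k) (s t : tens A B) : tens A B :=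
  tlift (fun (a : A) (b : B) => tlift (fun (c : A) (d : B) => (a * c) ⊗ (b * d)) t) s.

Lemma tprod_linear (k : fieldType) (U V : vectType k) (u : U) :
  linear (@tprod k U V u).
Proof.
by move=> a v w; apply/matrixP => i j; rewrite !mxE linearP mulrDr mulrCA.
Qed.

Lemma tprodr_linear (k : fieldType) (U V : vectType k) (v : V) :
  linear ((@tprod k U V)^~ v).
Proof.
by move=> a u w; apply/matrixP => i j; rewrite !mxE linearP mulrDl mulrA.
Qed.

Lemma tmulE (k : fieldType) (A B : falgType k) (a c : A) (b d : B) :
  tmul (a ⊗ b) (c ⊗ d) = (a * c) ⊗ (b * d).
Proof.
have E (u : A) (v : B) :
    tlift (fun (x : A) (y : B) => (u * x) ⊗ (v * y)) (c ⊗ d) = (u * c) ⊗ (v * d).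
  rewrite tliftE // => [x e y z|y e x z].
    by rewrite mulrDr -scalerAr tprod_linear.
  by rewrite mulrDr -scalerAr tprodr_linear.
rewrite /tmul; transitivity
    (tlift (fun (u : A) (v : B) => (u * c) ⊗ (v * d)) (a ⊗ b)).
  by apply: eq_bigr => i _; apply: eq_bigr => j _; rewrite E.
rewrite tliftE // => [x e y z|y e x z].
  by rewrite mulrDl -scalerAl tprod_linear.
by rewrite mulrDl -scalerAl tprodr_linear.
Qed.


Record hopf (k : fieldType) (H : falgType k) := Hopf {
  comul : 'Hom(H, tens H H);
  counit : {scalar H};
  antipode : 'End(H);
  comul1 : comul 1 = 1 ⊗ 1;
  comulM : forall a b : H, comul (a * b) = tmul (comul a) (comul b);
  counit1 : counit 1 = 1;
  counitM : forall a b : H, counit (a * b) = counit a * counit b;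
  comulA : forall h : H,
    tlift (fun h1 h2 => h1 ⊗ comul h2) (comul h) =
    tlift (fun h1 h2 => tlift (fun a b => a ⊗ (b ⊗ h2)) (comul h1)) (comul h);
  counitl : forall h, tlift (fun h1 h2 : H => counit h1 *: h2) (comul h) = h;
  counitr : forall h, tlift (fun h1 h2 : H => counit h2 *: h1) (comul h) = h;
  antipodel : forall h, tlift (fun h1 h2 : H => antipode h1 * h2 : H) (comul h)
                        = (counit h)%:A;
  antipoder : forall h, tlift (fun h1 h2 : H => h1 * antipode h2 : H) (comul h)
                        = (counit h)%:A }.

Record comodule_algebra (k : fieldType) (H : falgType k) (hH : hopf H)
    (A : falgType k) := ComoduleAlgebra {
  coact : 'Hom(A, tens A H);
  coact1 : coact 1 = 1 ⊗ 1;
  coactM : forall a b : A, coact (a * b) = tmul (coact a) (coact b);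
  coactA : forall a,
    tlift (fun a0 a1 => a0 ⊗ comul hH a1) (coact a) =
    tlift (fun a0 a1 => tlift (fun b c => b ⊗ (c ⊗ a1)) (coact a0)) (coact a);
  coact_counit : forall a,
    tlift (fun (a0 : A) (a1 : H) => counit hH a1 *: a0) (coact a) = a }.

(* Conditions (i)-(iii) of right-trivial separability of the cowreath
   (A ⊗ H^op, H, psi), psi(h ⊗ a ⊗ l) = a_0 ⊗ l_1 ⊗ l_2 h a_1, on the
   A-component BA of the Casimir element. *)
Record casimir_component (k : fieldType) (H : falgType k) (hH : hopf H)
    (A : falgType k) (cA : comodule_algebra hH A)
    (BA : 'Hom(tens H H, A)) : Prop := CasimirComponent {
  casimir_morphism : forall (a : A) (h h' : H),
    tlift (fun (a0 : A) (a12 : H) =>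
        tlift (fun a1 a2 : H => a0 * BA ((h * a1) ⊗ (h' * a2)) : A)
          (comul hH a12) : A)
      (coact cA a) = BA (h ⊗ h') * a;
  casimir_colinear : forall h : H,
    coact cA (BA (1 ⊗ h)) =
    tlift (fun h1 h2 => BA (1 ⊗ h1) ⊗ h2) (comul hH h);
  casimir_invariant : forall h h' h'' : H,
    tlift (fun h1 h2 : H => BA ((h1 * h') ⊗ (h2 * h''))) (comul hH h) =
    counit hH h *: BA (h' ⊗ h'');
  casimir_unit : BA (1 ⊗ 1) = 1 }.

(* H^op has the same underlying space and unit as H, and only these are used
   here, so the codomain A ⊗ H^op of B is written [tens A H]. *)
Definition has_component (k : fieldType) (H A : falgType k)
    (B : 'Hom(tens H H, tens A H)) (BA : 'Hom(tens H H, A)) : Prop :=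
  forall h h' : H, B (h ⊗ h') = BA (h ⊗ h') ⊗ (1 : H).

Definition rt_casimir (k : fieldType) (H : falgType k) (hH : hopf H)
    (A : falgType k) (cA : comodule_algebra hH A)
    (B : 'Hom(tens H H, tens A H)) : Prop :=
  exists2 BA, has_component B BA & casimir_component cA BA.

Definition rt_separable (k : fieldType) (H : falgType k) (hH : hopf H)
    (A : falgType k) (cA : comodule_algebra hH A) : Prop :=
  exists B, rt_casimir cA B.

(* The index set {1, ..., n} is 'I_n and {0, ..., n} is 'I_n.+1, with i in
   {1, ..., n} included as [lift ord0 i].  Products indexed by a set of ordinals
   are taken in increasing order. *)

Definition En_mon (k : fieldType) (n : nat) (H : falgType k) (x : 'I_n -> H)
    (P : {set 'I_n}) : H := \prod_(i in P) x i.

(* An algebra satisfying the relations on which the ordered monomials form a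
   basis is a model of the algebra presented by these relations; likewise for
   [is_Cl] below. *)
Record is_En (k : fieldType) (n : nat) (H : falgType k) (hH : hopf H)
    (g : H) (x : 'I_n -> H) : Prop := IsEn {
  En_gg : g ^+ 2 = 1;
  En_xx : forall i, x i ^+ 2 = 0;
  En_gx : forall i, g * x i = - (x i * g);
  En_xxC : forall i j : 'I_n, (i < j)%N -> x i * x j = - (x j * x i);
  En_basis : basis_of {:H}
    [seq g ^+ (jP.1 : bool) * En_mon x jP.2 | jP : bool * {set 'I_n}];
  En_comul_g : comul hH g = g ⊗ g;
  En_counit_g : counit hH g = 1;
  En_antipode_g : antipode hH g = g;
  En_comul_x : forall i, comul hH (x i) = x i ⊗ g + 1 ⊗ x i;
  En_counit_x : forall i, counit hH (x i) = 0;
  En_antipode_x : forall i, antipode hH (x i) = g * x i }.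

(* X_0 = G. *)
Definition Cl_gen (n : nat) (A : Type) (G : A) (X : 'I_n -> A) (i : 'I_n.+1) : A :=
  if unlift ord0 i is Some i' then X i' else G.

Definition Cl_mon (k : fieldType) (n : nat) (A : falgType k) (G : A)
    (X : 'I_n -> A) (R : {set 'I_n.+1}) : A := \prod_(i in R) Cl_gen G X i.

(* Only the values lambda i j with i < j are used. *)
Record is_Cl (k : fieldType) (n : nat) (alpha : k) (beta gamma : 'I_n -> k)
    (lambda : 'I_n -> 'I_n -> k) (A : falgType k) (G : A) (X : 'I_n -> A)
    : Prop := IsCl {
  Cl_GG : G ^+ 2 = alpha%:A;
  Cl_XX : forall i, X i ^+ 2 = (beta i)%:A;
  Cl_GX : forall i, G * X i + X i * G = (gamma i)%:A;
  Cl_XXC : forall i j : 'I_n,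
    (i < j)%N -> X i * X j + X j * X i = (lambda i j)%:A;
  Cl_basis : basis_of {:A} [seq Cl_mon G X R | R : {set 'I_n.+1}] }.

Definition canonical_coaction (k : fieldType) (n : nat) (H : falgType k)
    (hH : hopf H) (g : H) (x : 'I_n -> H) (A : falgType k)
    (cA : comodule_algebra hH A) (G : A) (X : 'I_n -> A) : Prop :=
  coact cA G = G ⊗ g /\ (forall i, coact cA (X i) = X i ⊗ g + 1 ⊗ x i).

(* S(F, P): the position in P of f is the number of elements p <= f of P. *)
Definition Spos (m : nat) (F P : {set 'I_m}) : nat :=
  \sum_(f in F) #|[set p in P | (p <= f)%N]| - (#|F| * #|F|.+1)./2.

Definition pi2 (m : nat) (U : {set 'I_m}) : {set {set {set 'I_m}}} :=
  [set PP | partition PP U && [forall P in PP, #|P| == 2]].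

(* The word s_{1_1} s_{1_2} s_{2_1} s_{2_2} ... of a perfect matching, its
   blocks being ordered by their largest elements; [enum] of a set of ordinals
   is increasing. *)
Definition matching_word (m : nat) (PP : {set {set 'I_m}}) : seq 'I_m :=
  flatten [seq enum P | P : {set 'I_m} <-
    sort (fun P Q : {set 'I_m} => (\max_(i in P) i <= \max_(i in Q) i)%N)
         (enum PP)].

(* Sends the i-th element of U to the i-th letter of the word, and fixes the
   elements outside U. *)
Definition matching_fun (m : nat) (U : {set 'I_m}) (PP : {set {set 'I_m}})
    (x : 'I_m) : 'I_m :=
  nth x (matching_word PP) (index x (enum U)).

(* The default value is not reached for PP in pi2 U: see [matching_permE]. *)
Definition matching_perm (m : nat) (U : {set 'I_m}) (PP : {set {set 'I_m}})
    : {perm 'I_m} :=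
  odflt 1%g [pick s : {perm 'I_m} | [forall x, s x == matching_fun U PP x]].

Lemma matching_permE (m : nat) (U : {set 'I_m}) (PP : {set {set 'I_m}}) :
  PP \in pi2 U -> matching_perm U PP =1 matching_fun U PP.
Proof.
rewrite inE => /andP[partPP _].
have memw x : (x \in matching_word PP) = (x \in U).
  rewrite -(cover_partition partPP); apply/flattenP/bigcupP.
    case=> s /mapP[P]; rewrite mem_sort mem_enum => PPP ->.
    by rewrite mem_enum; exists P.
  case=> P PPP xP; exists (enum P); last by rewrite mem_enum.
  by apply: map_f; rewrite mem_sort mem_enum.
have sizew : size (matching_word PP) = size (enum U).
  rewrite -cardE (card_partition partPP) size_flatten /shape -map_comp sumnE.
  rewrite big_map (perm_big (enum PP)) /=; last by rewrite perm_sort.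
  by rewrite big_enum; apply: eq_bigr => P _ /=; rewrite cardE.
have eqw : matching_word PP =i enum U by move=> x; rewrite memw mem_enum.
have uniqw : uniq (matching_word PP).
  by rewrite (eq_uniq sizew eqw) enum_uniq.
have outU x : x \notin U -> matching_fun U PP x = x.
  move=> xU; rewrite /matching_fun nth_default // sizew leqNgt index_mem.
  by rewrite mem_enum.
have inU x : x \in U -> matching_fun U PP x \in U.
  by move=> xU; rewrite -memw mem_nth // sizew index_mem mem_enum.
have inj : injective (matching_fun U PP).
  move=> x y; case: (boolP (x \in U)) => xU; case: (boolP (y \in U)) => yU.
  - rewrite /matching_fun (set_nth_default y); last first.
      by rewrite sizew index_mem mem_enum.
    move/eqP; rewrite nth_uniq ?sizew ?index_mem ?mem_enum // => /eqP ixy.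
    have [xe ye] : x \in enum U /\ y \in enum U by rewrite !mem_enum.
    by rewrite -(nth_index x xe) ixy nth_index.
  - by rewrite (outU y) // => exy; case/negP: yU; rewrite -exy inU.
  - by rewrite (outU x) // => exy; case/negP: xU; rewrite exy inU.
  - by rewrite !outU.
rewrite /matching_perm; case: pickP => [s /forallP sE x|/(_ (perm inj))/forallP[]].
  exact/eqP.
by move=> x; rewrite permE.
Qed.

Definition matching_sgn (k : fieldType) (m : nat) (U : {set 'I_m})
    (PP : {set {set 'I_m}}) : k := (-1) ^+ odd_perm (matching_perm U PP).

(* lambda_{ij} for 0 <= i < j <= n, with lambda_{0j} = gamma_j. *)
Definition lambda0 (k : fieldType) (n : nat) (gamma : 'I_n -> k)
    (lambda : 'I_n -> 'I_n -> k) (i j : 'I_n.+1) : k :=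
  match unlift ord0 i, unlift ord0 j with
  | Some i', Some j' => lambda i' j'
  | None, Some j' => gamma j'
  | _, None => 0
  end.

Definition Lambda (k : fieldType) (n : nat) (gamma : 'I_n -> k)
    (lambda : 'I_n -> 'I_n -> k) (PP : {set {set 'I_n.+1}}) : k :=
  \prod_(P in PP) if enum P is [:: i; j] then lambda0 gamma lambda i j else 0.

(* Qbar = Q ⊔ {0}. *)
Definition Qbar (n : nat) (Q : {set 'I_n}) : {set 'I_n.+1} :=
  ord0 |: [set lift ord0 i | i in Q].

(* Q \ R for Q in {1, ..., n} and R in {0, ..., n}. *)
Definition Qminus (n : nat) (Q : {set 'I_n}) (R : {set 'I_n.+1}) : {set 'I_n} :=
  [set i in Q | lift ord0 i \notin R].

Definition casimir_formula (k : fieldType) (n : nat) (alpha : k)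
    (gamma : 'I_n -> k) (lambda : 'I_n -> 'I_n -> k)
    (H : falgType k) (hH : hopf H) (g : H) (x : 'I_n -> H)
    (A : falgType k) (G : A) (X : 'I_n -> A)
    (mu : k) (eta : {set 'I_n} -> k) (BA : 'Hom(tens H H, A)) : Prop :=
  [/\ forall (j k : bool) (P Q : {set 'I_n}),
        BA ((g ^+ j * En_mon x P) ⊗ (g ^+ k * En_mon x Q)) =
        BA (1 ⊗ (antipode hH (g ^+ j * En_mon x P) * (g ^+ k * En_mon x Q))),
      BA (1 ⊗ 1) = 1,
      forall Q : {set 'I_n},
        BA (1 ⊗ En_mon x Q) =
        \sum_(R : {set 'I_n.+1} | (R \subset Qbar Q) && (odd #|R| == odd #|Q|))
          ((-1) ^+ Spos (Qminus Q R) Q * eta (Qminus Q R)) *: Cl_mon G X R,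
      forall Q : {set 'I_n},
        BA (1 ⊗ (g * En_mon x Q)) =
        (mu / 2%:R ^+ (#|Qbar Q|./2)) *:
        \sum_(R : {set 'I_n.+1} |
               (R \subset Qbar Q) && (odd #|R| == odd #|Qbar Q|))
          ((-1) ^+ (Spos R (Qbar Q) + (#|Qbar Q| - #|R|)./2)
           * 2%:R ^+ (#|R|./2)
           * \sum_(PP in pi2 (Qbar Q :\: R))
               matching_sgn k (Qbar Q :\: R) PP * Lambda gamma lambda PP)
          *: Cl_mon G X R
    & alpha != 0 -> forall T : {set 'I_n}, odd #|T| ->
        eta T = \sum_(i in T) (-1) ^+ (Spos [set i] T).+1 * eta (T :\ i)
                              * (gamma i / (2%:R * alpha))].

(* Main.v *)
Require Import Defs.
From HB Require Import structures.
From mathcomp Require Import all_boot all_order all_fingroup all_algebra all_field.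
From mathcomp Require Import zify ring.

(** Write H = E(n), S for its antipode and B for B^A.

    Inserting h_1 ⊗ h_2 S(h_3) for h ⊗ 1 shows that the invariance condition
    means B(h ⊗ h') = b(S(h)h') with b = B(1 ⊗ -) ([casimir_invariantP]). The
    colinearity condition then says that b : H -> A is a comodule map, and the
    morphism condition, being multiplicative in a, only has to be tested on
    generators ([morphism_atM]), where it reads
      G b(ghg) = b(h) G   and   X_i b(ghg) + b(g x_i h g) + b(h x_i) = b(h) X_i.

    The coproduct of an ordered monomial of H only involves ordered monomials
    and so does the coaction on an ordered monomial of A, with the same
    coefficients, whatever the parameters of A are ([skew_mon]). Hence
    j(g^a x_P) = G^a X_P defines an isomorphism of comodules H -> A
    ([coact_mon_iso]), and the comodule maps are b(h) = θ(h_1) j(h_2) for an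
    arbitrary functional θ ([colinear_mon], [colinear_of_coef]); here θ = π b,
    where π = ε j^-1 adds up the coefficients at 1 and at G. The parameters
    eta_T of the theorem are the values θ(x_T).

    The defects c(h) of the two equations above satisfy
    ρ(c(h)) = c(h_1) ⊗ h_2 g, so a defect vanishes at g^a x_Q as soon as π kills
    its values at the g^a x_F, F a subset of Q ([twisted_colinear_mon]). This turns each
    equation into a scalar identity:

    - For h = x_Q they say that b(x_Q) supercommutes with G and the X_i.
      Already for b(x_i) = X_i + c G this forces the quadratic form of A to be
      alpha times the square of a linear form, which leaves the two cases of the
      theorem ([casimir_map_cases]). Conversely the X_i - c_i G are
      then supercentral, so that only G matters, and the scalar identity is the
      recursion for eta_T, |T| odd ([const_coef_Gdefect]).
    - For h = g x_Q the second equation says that b(g x_Q x_i) is the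
      antisymmetrized product of b(g x_Q) and X_i. Since b(g) = mu G, this makes
      b(g x_Q) equal to mu times the antisymmetrization of G and the X_i, i in
      Q, which exists without any condition on A. It suffices to treat Q < i,
      because antisymmetrized products anticommute ([wedge_anticomm]), and then
      the scalar identity ([const_coef_Xdefect]) is the expansion along the
      last row of the Pfaffian ([pfaffian_expand]), which produces the sum over
      perfect matchings. *)

Set Implicit Arguments.
Unset Strict Implicit.
Unset Printing Implicit Defensive.
Import GRing.Theory.
Local Open Scope ring_scope.

(** * Sets of ordinals, ordered products and signs *)

Section OrdinalSets.
Variable m : nat.
Implicit Types (A B F P U : {set 'I_m}) (z r : 'I_m).

(** Ordered products are built by appending factors on the right, so inductions
    on index sets add a new largest element. *)
Lemma set_max_ind (K : {set 'I_m} -> Prop) :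
  K set0 ->
  (forall P z, (forall p, p \in P -> (p < z)%N) -> K P -> K (z |: P)) ->
  forall P, K P.
Proof.
move=> K0 KS P; have [c] := ubnP #|P|; elim: c P => // c IH P leP.
have [->//|[i0 iP]] := set_0Vmem P.
have [z zP zmax] := arg_maxnP (@nat_of_ord m) iP.
rewrite -(setD1K zP); apply: KS => [p|].
  by rewrite !inE ltn_neqAle => /andP[-> /zmax].
by apply: IH; rewrite (cardsD1 z) (zP : z \in P) in leP.
Qed.

Lemma enum_setU1_max P z :
  (forall p, p \in P -> (p < z)%N) -> enum (z |: P) = rcons (enum P) z.
Proof.
move=> Pz; pose r := relpre (@nat_of_ord m) ltn.
have s_enum (A : {set 'I_m}) : sorted r (enum A).
  have: sorted r (enum 'I_m) by rewrite -sorted_map val_enum_ord iota_ltn_sorted.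
  have -> : enum A = [seq i <- enum 'I_m | i \in A] by rewrite enumT.
  by apply: sorted_filter => a b c; apply: ltn_trans.
apply: (@irr_sorted_eq _ r) => //.
- by move=> a b c; apply: ltn_trans.
- by move=> a; rewrite /r /= ltnn.
- have r_tr : transitive r by move=> a b c; apply: ltn_trans.
  rewrite sorted_pairwise // pairwise_rcons -sorted_pairwise // s_enum andbT.
  by apply/allP => p; rewrite mem_enum => /Pz.
by move=> p; rewrite mem_rcons in_cons !mem_enum !inE.
Qed.

Lemma prod_setU1_max (R : pzSemiRingType) (y : 'I_m -> R) P z :
  (forall p, p \in P -> (p < z)%N) ->
  \prod_(i in z |: P) y i = (\prod_(i in P) y i) * y z.
Proof.
(* the factors do not commute, so the enumerations have to agree as words *)
have prodE (A : {set 'I_m}) : \prod_(i in A) y i = \prod_(i <- enum A) y i.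
  by rewrite -big_filter [index_enum _]unlock.
by move=> Pz; rewrite !prodE enum_setU1_max // -cats1 big_cat big_seq1.
Qed.

Lemma notin_max P z : (forall p, p \in P -> (p < z)%N) -> z \notin P.
Proof. by move=> Pz; apply/negP => /Pz; rewrite ltnn. Qed.

(** For disjoint A and B this is the number of transpositions that bring the
    elements of A in front of those of B in an increasing word on A :|: B. *)
Definition ninv A B : nat := \sum_(a in A) \sum_(b in B) (b < a)%N.

Lemma ninv0l B : ninv set0 B = 0%N. Proof. exact: big_set0. Qed.

Lemma ninv0r A : ninv A set0 = 0%N.
Proof. by apply: big1 => a _; rewrite big_set0. Qed.

Lemma ninvU1l A B z : z \notin A -> ninv (z |: A) B = (ninv [set z] B + ninv A B)%N.
Proof. by move=> zA; rewrite /ninv big_setU1 // big_set1. Qed.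

Lemma ninvU1r A B z : z \notin B -> ninv A (z |: B) = (ninv A [set z] + ninv A B)%N.
Proof.
move=> zB; rewrite /ninv -big_split; apply: eq_bigr => a _.
by rewrite big_setU1 // big_set1.
Qed.

Lemma ninv_set1r A z : ninv A [set z] = #|[set a in A | (z < a)%N]|.
Proof.
rewrite /ninv -sum1_card big_mkcond [RHS]big_mkcond; apply: eq_bigr => a _.
by rewrite big_set1 inE; case: (a \in A); case: (_ < _)%N.
Qed.

Lemma ninv_set1l B z : ninv [set z] B = #|[set b in B | (b < z)%N]|.
Proof.
rewrite /ninv big_set1 -sum1_card big_mkcond [RHS]big_mkcond; apply: eq_bigr => b _.
by rewrite inE; case: (b \in B); case: (_ < _)%N.
Qed.

Lemma ninv_addC A B : [disjoint A & B] -> (ninv A B + ninv B A = #|A| * #|B|)%N.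
Proof.
move=> dAB; rewrite /ninv [X in (_ + X)%N]exchange_big -big_split /=.
rewrite -sum_nat_const; apply: eq_bigr => a aA.
rewrite -big_split -sum1_card; apply: eq_bigr => b bB /=.
case: ltngtP => // /val_inj ab; move/pred0P/(_ a): dAB => /=.
by rewrite aA -ab bB.
Qed.

Lemma ninv_lt A z : (forall a, a \in A -> (a < z)%N) -> ninv A [set z] = 0%N.
Proof.
move=> Az; rewrite /ninv big1 // => a /Az az.
by rewrite big_set1 ltnNge ltnW.
Qed.

Lemma ninv_gt A z : (forall a, a \in A -> (a < z)%N) -> ninv [set z] A = #|A|.
Proof.
by move=> Az; rewrite /ninv big_set1 -sum1_card; apply: eq_bigr => a /Az ->.
Qed.

(** An element f of F has as position in P the number of elements of P outside F
    below f plus its position in F; the latter positions add up to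
    1 + ... + |F|, the term that is subtracted. *)
Lemma SposE F P : F \subset P -> Spos F P = ninv F (P :\: F).
Proof.
move=> FP; pose le A (f : 'I_m) := #|[set p in A | (p <= f)%N]|.
have split_le f : f \in F -> le P f = ((\sum_(b in P :\: F) (b < f)%N) + le F f)%N.
  move=> fF; rewrite /le -(cardsID F) addnC; congr (_ + _)%N.
    rewrite -sum1_card big_mkcond [RHS]big_mkcond; apply: eq_bigr => p _.
    rewrite !inE; case: (boolP (p \in F)) => //= pF; case: (p \in P) => //=.
    rewrite leq_eqVlt -[(_ == _ :> nat)]/(p == f).
    by have [pf|_] := eqVneq p f; [rewrite pf fF in pF | case: (_ < _)%N].
  congr #|pred_of_set _|; apply/setP => p; rewrite !inE andbC andbA.
  by case: (boolP (p \in F)) => //= pF; rewrite (subsetP FP).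
have -> : Spos F P = (ninv F (P :\: F) + \sum_(f in F) le F f - (#|F| * #|F|.+1)./2)%N.
  by rewrite /Spos /ninv -big_split; congr (_ - _)%N; apply: eq_bigr => f /split_le.
suff -> : (\sum_(f in F) le F f = (#|F| * #|F|.+1)./2)%N by rewrite addnK.
elim/set_max_ind: {P FP split_le} F => [|P z Pz IH]; first by rewrite big_set0 cards0.
have zP := notin_max Pz; rewrite big_setU1 //= cardsU1 zP add1n.
have -> : le (z |: P) z = #|P|.+1.
  rewrite /le -add1n -[1%N]/(nat_of_bool true) -zP -cardsU1.
  congr #|pred_of_set _|; apply/setP => p; rewrite !inE.
  by have [->|_] := eqVneq p z; rewrite ?leqnn //=; case: (boolP (p \in P)) => // /Pz /ltnW ->.
rewrite (eq_bigr (fun f => le P f)) => [|f fP].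
  by rewrite IH; rewrite -[(#|P|.+1 * _)%N]addn0 mulnS mulnC; lia.
congr #|pred_of_set _|; apply/setP => p; rewrite !inE.
by have [->|_] := eqVneq p z; rewrite //= (negPf zP) leqNgt Pz.
Qed.

End OrdinalSets.

Lemma sum_subsetU1 (m : nat) (V : nmodType) (z : 'I_m) (P : {set 'I_m})
    (f : {set 'I_m} -> V) : z \notin P ->
  \sum_(F : {set 'I_m} | F \subset z |: P) f F =
  \sum_(F : {set 'I_m} | F \subset P) f F +
  \sum_(F : {set 'I_m} | F \subset P) f (z |: F).
Proof.
move=> zP; rewrite (bigID (fun F : {set 'I_m} => z \in F)) addrC /=; congr (_ + _); last first.
  apply: eq_bigl => F; rewrite -[z |: P]setUC.
  apply/andP/idP => [[/subsetP sF zF]|FP].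
    apply/subsetP => p pF; have := sF p pF; rewrite !inE => /orP[//|/eqP pz].
    by rewrite -pz pF in zF.
  by rewrite (subset_trans FP) ?subsetUl //; split=> //; apply: contra zP; apply: subsetP.
rewrite (reindex_onto (fun F => z |: F) (fun F => F :\ z)) /=; last first.
  by move=> F /andP[_ zF]; rewrite setD1K.
apply: eq_bigl => F; rewrite setU11 andbT.
apply/andP/idP => [[/subsetP sF /eqP eF]|FP].
  have zF : z \notin F by rewrite -eF setD11.
  apply/subsetP => p pF; have := sF p; rewrite !inE pF orbT => /(_ isT)/orP[/eqP pz|//].
  by rewrite -pz pF in zF.
by rewrite setUS // setU1K //; apply: contra zP; apply: subsetP.
Qed.

(** * Pfaffians as sums over perfect matchings *)

(** Moving a letter r to the right across a word is a cycle, that is, a product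
    of adjacent transpositions. *)
Lemma odd_perm_cycle (T : finType) (c : {perm T}) (l1 l2 : seq T) (r : T) :
  uniq (l1 ++ r :: l2) ->
  map c (l1 ++ r :: l2) = l1 ++ rcons l2 r ->
  (forall y, y \notin l1 ++ r :: l2 -> c y = y) ->
  odd_perm c = odd (size l2).
Proof.
elim: l2 l1 c => [|a l2 IH] l1 c uniql mapc offc.
  suff -> : c = 1%g by rewrite odd_perm1.
  apply/permP => y; rewrite perm1; case: (boolP (y \in l1 ++ [:: r])) => [yl|/offc//].
  by move: mapc; rewrite /= -[in RHS](map_id (l1 ++ _)) => /eq_in_map ->.
have := uniql; rewrite cat_uniq /= negb_or in_cons !negb_or.
case/and5P=> [_ /and3P[rl1 al1 _] /andP[ra rl2] al2 _].
have c'E l : r \notin l -> a \notin l -> map (tperm r a * c)%g l = map c l.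
  move=> rl al; apply/eq_in_map => y yl; rewrite permM tpermD //.
    by apply: contraNneq rl => ->.
  by apply: contraNneq al => ->.
have IHc : odd_perm (tperm r a * c)%g = odd (size l2).
  apply: (IH (rcons l1 a)); rewrite ?cat_rcons.
  - rewrite -(perm_uniq (s1 := l1 ++ r :: a :: l2)) // perm_cat2l.
    by rewrite -[_ :: _ :: _]/([:: r] ++ [:: a] ++ l2) perm_catCA.
  - move: mapc; rewrite !map_cat /= !permM tpermL tpermR !c'E // => ->; rewrite ?cat_rcons.
  - move=> y; rewrite mem_cat !in_cons !negb_or => /and4P[yl1 ya yr yl2].
    rewrite permM tpermD 1?eq_sym // offc //.
    by rewrite mem_cat !in_cons !negb_or yl1 ya yr yl2.
by move: IHc; rewrite odd_mul_tperm ra /= => <-; rewrite negbK.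
Qed.

Section Pfaffian.
Variables (k : fieldType) (m : nat) (w : {set 'I_m} -> k).
Implicit Types (U : {set 'I_m}) (PP : {set {set 'I_m}}) (z r : 'I_m).

(** If w [set r; s], for r < s, is the entry at (r, s) of an antisymmetric matrix,
    this is the Pfaffian of its submatrix on U. *)
Definition pfaffian U : k :=
  \sum_(PP in pi2 U) matching_sgn k U PP * \prod_(P in PP) w P.

Lemma pi2_set0 : pi2 (set0 : {set 'I_m}) = [set set0].
Proof.
apply/setP => PP; rewrite !inE partition_set0.
by case: eqVneq => //= ->; apply/forall_inP => P; rewrite inE.
Qed.

Lemma map_matching_perm U PP : PP \in pi2 U ->
  map (matching_perm U PP) (enum U) = matching_word PP.
Proof.
move=> PPi; have sizew : size (matching_word PP) = size (enum U).
  have := PPi; rewrite inE => /andP[part _].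
  rewrite -cardE (card_partition part) size_flatten /shape -map_comp sumnE big_map.
  rewrite (perm_big (enum PP)) /=; last by rewrite perm_sort.
  by rewrite big_enum; apply: eq_bigr => P _ /=; rewrite cardE.
have [U0|[y0 _]] := set_0Vmem U.
  by move: sizew; rewrite U0 enum_set0 => /size0nil ->.
apply: (@eq_from_nth _ y0); rewrite size_map // => i ilt.
rewrite (nth_map y0) // (matching_permE PPi) /matching_fun index_uniq ?enum_uniq //.
by apply: set_nth_default; rewrite sizew.
Qed.

Lemma matching_perm_out U PP y : PP \in pi2 U -> y \notin U ->
  matching_perm U PP y = y.
Proof.
move=> PPi yU; rewrite (matching_permE PPi) /matching_fun nth_default //.
rewrite -(map_matching_perm PPi) size_map leqNgt index_mem mem_enum //.
Qed.

Lemma enum_split U r : r \in U ->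
  exists l1 l2, [/\ enum U = l1 ++ r :: l2, enum (U :\ r) = l1 ++ l2
    & size l2 = #|[set s in U | (r < s)%N]|].
Proof.
elim/set_max_ind: U => [|U z Uz IH]; first by rewrite inE.
have zU := notin_max Uz; rewrite enum_setU1_max // => /setU1P[->|rU].
  exists (enum U), [::]; rewrite cats1 cats0 setU1K //; split=> //=.
  apply/esym/eqP; rewrite cards_eq0 -subset0; apply/subsetP => s; rewrite !inE.
  by case/andP=> /predU1P[->|/Uz sz]; rewrite ?ltnn // ltnNge ltnW.
have [l1 [l2 [eU eUr sl2]]] := IH rU.
have rz : r != z by apply: contraNneq zU => <-.
exists l1, (rcons l2 z); split.
- by rewrite eU rcons_cat.
- have -> : (z |: U) :\ r = z |: (U :\ r).
    by apply/setP => s; rewrite !inE; case: eqVneq => // ->; rewrite (negPf rz).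
  by rewrite enum_setU1_max ?eUr ?rcons_cat // => s /setD1P[_ /Uz].
rewrite size_rcons sl2 -add1n -[1%N]/(nat_of_bool true).
have -> : true = (z \notin [set s in U | (r < s)%N]) by rewrite inE (negPf zU).
rewrite -cardsU1; congr #|pred_of_set _|; apply/setP => s; rewrite !inE.
by case: eqVneq => //= ->; rewrite Uz.
Qed.

Lemma pi2_blocks U PP P : PP \in pi2 U -> P \in PP -> P \subset U /\ P != set0.
Proof.
rewrite inE => /andP[part /forall_inP sz] PPP; split.
  by rewrite -(cover_partition part); apply: (bigcup_sup P).
by rewrite -card_gt0 (eqP (sz _ PPP)).
Qed.

Section AddMax.
Variables (U : {set 'I_m}) (z r : 'I_m).
Hypotheses (Uz : forall s, s \in U -> (s < z)%N) (rU : r \in U).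
Let zU := notin_max Uz.
Let rz : r != z. Proof. by apply: contraNneq zU => <-. Qed.

Lemma pi2_add PP : PP \in pi2 (U :\ r) -> [set r; z] |: PP \in pi2 (z |: U).
Proof.
rewrite !inE => /andP[part /forall_inP sz]; apply/andP; split.
  have -> : z |: U = [set r; z] :|: (U :\ r).
    apply/setP => s; rewrite !inE; have [->|] := eqVneq s r; first by rewrite rU orbT.
    by [].
  apply: partitionU1 => //; first by rewrite -card_gt0 cards2.
  rewrite disjoints_subset; apply/subsetP => s; rewrite !inE => /orP[]/eqP->.
    by rewrite eqxx.
  by rewrite (negPf zU) andbF.
apply/forall_inP => P /setU1P[->|/sz//]; by rewrite cards2 rz.
Qed.

Lemma pi2_del PP : PP \in pi2 (z |: U) -> [set r; z] \in PP ->
  PP :\ [set r; z] \in pi2 (U :\ r).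
Proof.
rewrite !inE => /andP[part /forall_inP sz] rzPP; apply/andP; split.
  have -> : U :\ r = (z |: U) :\: [set r; z].
    apply/setP => s; rewrite !inE; have [->|] //= := eqVneq s r.
    by have [->|] //= := eqVneq s z; rewrite (negPf zU).
  exact: partitionD1.
by apply/forall_inP => P /setD1P[_ /sz].
Qed.

Lemma pair_notin PP : PP \in pi2 (U :\ r) -> [set r; z] \notin PP.
Proof.
move=> PPi; apply/negP => /(pi2_blocks PPi)[/subsetP/(_ r)].
by rewrite !inE eqxx => /(_ isT).
Qed.

(** The block of the largest element has the largest maximum, hence comes last
    in the word. *)
Lemma matching_word_add PP : PP \in pi2 (U :\ r) ->
  matching_word ([set r; z] |: PP) = matching_word PP ++ [:: r; z].
Proof.
move=> PPi; pose key (P : {set 'I_m}) := (\max_(i in P) i)%N.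
pose le (P Q : {set 'I_m}) := (key P <= key Q)%N.
have wordE QQ : matching_word QQ =
    flatten (map (fun P : {set 'I_m} => enum P) (sort le (enum QQ))) by [].
rewrite !wordE.
have le_tr : transitive le by move=> P Q S; apply: leq_trans.
have le_tot : total le by move=> P Q; apply: leq_total.
pose s := sort le (enum PP).
have keyP UU QQ P : QQ \in pi2 UU -> P \in QQ -> exists2 i, i \in P & key P = i.
  move=> QQi /(pi2_blocks QQi)[_]; rewrite -card_gt0 => P0.
  by have [i iP ei] := eq_bigmax_cond (fun i : 'I_m => i : nat) P0; exists i.
have key_rz : key [set r; z] = z.
  rewrite /key big_setU1 ?inE ?(negPf rz) //= big_set1.
  by apply/maxn_idPr/ltnW/Uz.
have key_lt P : P \in PP -> (key P < z)%N.
  move=> PPP; have [i iP ->] := keyP _ _ P PPi PPP.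
  have [/subsetP sub _] := pi2_blocks PPi PPP.
  by have := sub _ iP; rewrite inE => /andP[_ /Uz].
have sortE : sort le (enum ([set r; z] |: PP)) = rcons s [set r; z].
  have sorted_s : sorted le (rcons s [set r; z]).
    rewrite sorted_pairwise // pairwise_rcons -sorted_pairwise // sort_sorted // andbT.
    apply/allP => P; rewrite mem_sort mem_enum => PPP.
    by rewrite /le key_rz ltnW // key_lt.
  rewrite -[RHS](sorted_sort le_tr sorted_s); apply/perm_sort_inP.
  - by move=> P Q _ _; apply: le_tot.
  - by move=> P Q S _ _ _; apply: le_tr.
  - move=> P Q; rewrite !mem_enum => PPP QPP; rewrite -eqn_leq => /eqP eqk.
    have PPi' := pi2_add PPi.
    have [[i iP ki] [j jQ kj]] := (keyP _ _ _ PPi' PPP, keyP _ _ _ PPi' QPP).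
    have ij : i = j by apply: val_inj; rewrite /= -ki -kj.
    move: PPi'; rewrite inE => /andP[/and3P[_ /trivIsetP triv _] _].
    apply: contraTeq iP => /(triv _ _ PPP QPP)/disjointFl; rewrite ij => -> //.
  - apply: uniq_perm; rewrite ?enum_uniq //.
      by rewrite rcons_uniq mem_sort sort_uniq mem_enum pair_notin ?enum_uniq.
    by move=> P; rewrite mem_rcons in_cons mem_sort !mem_enum !inE.
rewrite sortE -cats1 map_cat flatten_cat /= cats0; congr (_ ++ _).
have -> : [set r; z] = z |: [set r] by rewrite setUC.
by rewrite enum_setU1_max ?enum_set1 // => p; rewrite inE => /eqP ->; apply: Uz.
Qed.

(** The permutation of z |: U is the cycle that moves r behind the elements of U
    larger than r, followed by the permutation of the smaller matching. *)
Lemma matching_sgn_add PP : PP \in pi2 (U :\ r) ->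
  matching_sgn k (z |: U) ([set r; z] |: PP) =
  (-1) ^+ #|[set s in U | (r < s)%N]| * matching_sgn k (U :\ r) PP.
Proof.
move=> PPi; rewrite /matching_sgn -(signr_odd _ #|_|) -signr_addb; congr (_ ^+ _).
set s := matching_perm _ _; set s' := matching_perm _ _.
have sE := matching_permE (pi2_add PPi); have s'E := matching_permE PPi.
have [l1 [l2 [eU eUr <-]]] := enum_split rU.
suff: odd_perm (s * s'^-1)%g = odd (size l2).
  by rewrite odd_permM odd_permV => <-; rewrite -addbA addbb addbF.
apply: (@odd_perm_cycle _ _ l1 _ r).
- by rewrite -eU enum_uniq.
- have: map s (enum (z |: U)) = map s' (l1 ++ l2 ++ [:: r; z]).
    rewrite (map_matching_perm (pi2_add PPi)) matching_word_add // catA -eUr map_cat.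
    rewrite (map_matching_perm PPi); congr (_ ++ _) => /=.
    by rewrite !(matching_perm_out PPi) // !inE ?eqxx // (negPf zU) andbF.
  rewrite enum_setU1_max // eU => /(congr1 (map s'^-1%g)).
  have s'K : cancel s' s'^-1%g by apply: permK.
  rewrite (mapK s'K) -map_comp map_rcons.
  rewrite -[[:: r; z]]/([:: r] ++ [:: z]) !catA cats1 => /rcons_inj[eqs _].
  by rewrite -cats1 catA -eqs; apply: eq_map => y; rewrite permM.
move=> y; rewrite -eU mem_enum => yU; rewrite permM.
suff -> : s y = s' y by rewrite permK.
rewrite (matching_perm_out PPi) ?inE ?(negPf yU) ?andbF //.
have [->|yz] := eqVneq y z; last first.
  by rewrite (matching_perm_out (pi2_add PPi)) // !inE negb_or yz.
have := map_matching_perm (pi2_add PPi).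
rewrite matching_word_add // enum_setU1_max // map_rcons -[_ :: _]cat1s catA cats1.
by case/rcons_inj.
Qed.
End AddMax.

(** Expansion of a Pfaffian along its last row: split off the block of the
    largest element z, which comes last in the word of every matching. *)
Lemma pfaffian_expand U z : (forall s, s \in U -> (s < z)%N) ->
  pfaffian (z |: U) =
  \sum_(r in U) (-1) ^+ #|[set s in U | (r < s)%N]| * w [set r; z] * pfaffian (U :\ r).
Proof.
move=> Uz; have zU := notin_max Uz.
pose mate PP : 'I_m := odflt z [pick r in U | [set r; z] \in PP].
have rzE r r' PP : PP \in pi2 (z |: U) -> r \in U -> [set r; z] \in PP ->
    [set r'; z] \in PP -> r' \in U -> r = r'.
  move=> PPi rU rPP r'PP r'U; move: PPi; rewrite inE => /andP[/and3P[_ /trivIsetP triv _] _].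
  have [eqrr|neq] := eqVneq [set r; z] [set r'; z].
    have: r \in [set r'; z] by rewrite -eqrr set21.
    by rewrite !inE => /orP[/eqP//|/eqP rz]; rewrite -rz rU in zU.
  by have /disjointFr/(_ (set22 _ _)) := triv _ _ rPP r'PP neq; rewrite set22.
have mateP PP : PP \in pi2 (z |: U) -> mate PP \in U /\ [set mate PP; z] \in PP.
  move=> PPi; suff [r rU rPP]: exists2 r, r \in U & [set r; z] \in PP.
    rewrite /mate; case: pickP => [r' /andP[]//|/(_ r)/=].
    by rewrite rU rPP.
  move: (PPi); rewrite inE => /andP[part /forall_inP sz].
  have zcov : z \in cover PP by rewrite (cover_partition part) setU11.
  have PPz : pblock PP z \in PP by rewrite pblock_mem.
  have zB : z \in pblock PP z by rewrite mem_pblock.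
  have /cards2P[a [b [ab eB]]] := sz _ PPz.
  have subB : pblock PP z \subset z |: U by have [] := pi2_blocks PPi PPz.
  wlog zb : a b ab eB / z = b.
    move=> wl; move: (zB); rewrite {1}eB !inE => /orP[]/eqP zab; last exact: (wl a b).
    by apply: (wl b a); rewrite // 1?eq_sym // setUC.
  exists a; last by rewrite zb -eB.
  have: a \in z |: U by rewrite (subsetP subB) // eB set21.
  by rewrite !inE zb (negPf ab).
rewrite /pfaffian (partition_big mate (mem U)) => [|PP /mateP[]//].
apply: eq_bigr => r rU; rewrite mulr_sumr.
rewrite (reindex_onto (fun PP => [set r; z] |: PP) (fun PP => PP :\ [set r; z])) /=; last first.
  by move=> PP /andP[PPi /eqP mr]; rewrite setD1K // -mr; case: (mateP _ PPi).
apply: eq_big => [PP|PP PPi].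
  apply/idP/idP => [/andP[/andP[PPi _] /eqP PPE]|PPi].
    by rewrite -PPE pi2_del // ?setU11.
  have PPi' := pi2_add Uz rU PPi; have nP : [set r; z] \notin PP by apply: pair_notin PPi.
  rewrite PPi' setU1K // eqxx andbT.
  have [mU mPP] := mateP _ PPi'; apply/eqP.
  by apply: (rzE _ _ _ PPi') => //; apply: setU11.
have {}PPi : PP \in pi2 (U :\ r).
  by case/andP: PPi => /andP[PPi _] /eqP <-; rewrite pi2_del // ?setU11.
have nP : [set r; z] \notin PP by apply: pair_notin PPi.
rewrite matching_sgn_add // big_setU1 //=; ring.
Qed.

Lemma pfaffian0 : pfaffian set0 = 1.
Proof.
have P0 : set0 \in pi2 (set0 : {set 'I_m}) by rewrite pi2_set0 set11.
rewrite /pfaffian pi2_set0 big_set1 big_set0 mulr1 /matching_sgn.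
suff -> : matching_perm (set0 : {set 'I_m}) set0 = 1%g by rewrite odd_perm1.
by apply/permP => y; rewrite (matching_perm_out P0) ?inE // perm1.
Qed.

End Pfaffian.

(** * Multilinear maps on tensor products *)

Section Tensors.
Variable k : fieldType.
Implicit Types U V W : vectType k.

Definition hom_of_linear U V (f : U -> V) (flin : linear f) : 'Hom(U, V) :=
  linfun (HB.pack_for {linear U -> V} f (GRing.isLinear.Build k U V *:%R f flin)).

Lemma hom_of_linearE U V (f : U -> V) (flin : linear f) u :
  hom_of_linear flin u = f u.
Proof. by rewrite /hom_of_linear lfunE. Qed.

Definition bilin U V W (f : U -> V -> W) : Prop :=
  (forall u, linear (f u)) /\ (forall v, linear (f^~ v)).

Lemma tlift_tprod U V W (f : U -> V -> W) u v : bilin f -> tlift f (u ⊗ v) = f u v.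
Proof. by case=> fr fl; rewrite tliftE. Qed.

Lemma eq_tlift U V W (f f' : U -> V -> W) t :
  (forall u v, f u v = f' u v) -> tlift f t = tlift f' t.
Proof. by move=> ff'; apply: eq_bigr => i _; apply: eq_bigr => j _; rewrite ff'. Qed.

Lemma tliftD U V W (f : U -> V -> W) s t : tlift f (s + t) = tlift f s + tlift f t.
Proof. by rewrite -[s]scale1r tlift_linear !scale1r. Qed.

Lemma tlift0 U V W (f : U -> V -> W) : tlift f 0 = 0.
Proof. by apply: big1 => i _; apply: big1 => j _; rewrite mxE scale0r. Qed.

Lemma tliftZ U V W (f : U -> V -> W) a t : tlift f (a *: t) = a *: tlift f t.
Proof. by rewrite -[a *: t]addr0 tlift_linear tlift0 addr0. Qed.

Lemma tlift_sum U V W (f : U -> V -> W) (I : finType) (P : pred I) (t : I -> tens U V) :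
  tlift f (\sum_(i | P i) t i) = \sum_(i | P i) tlift f (t i).
Proof.
by apply: (big_morph (tlift f)); [apply: tliftD | apply: tlift0].
Qed.

Lemma tlift_add U V W (f f' : U -> V -> W) t :
  tlift (fun u v => f u v + f' u v) t = tlift f t + tlift f' t.
Proof.
rewrite /tlift -big_split; apply: eq_bigr => i _; rewrite -big_split.
by apply: eq_bigr => j _; rewrite scalerDr.
Qed.

Lemma linear_tlift U V W W' (L : W -> W') (f : U -> V -> W) t :
  linear L -> L (tlift f t) = tlift (fun u v => L (f u v)) t.
Proof.
move=> Llin; rewrite -(hom_of_linearE Llin) linear_sum; apply: eq_bigr => i _.
rewrite linear_sum; apply: eq_bigr => j _.
by rewrite linearZ /= hom_of_linearE.
Qed.

Lemma tlift_linear_param U V W (Z : vectType k) (F : Z -> U -> V -> W) t :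
  (forall u v, linear (fun z => F z u v)) -> linear (fun z => tlift (F z) t).
Proof.
move=> Flin a y z; rewrite /tlift scaler_sumr -big_split; apply: eq_bigr => i _ /=.
rewrite scaler_sumr -big_split; apply: eq_bigr => j _ /=.
by rewrite Flin scalerDr !scalerA mulrC.
Qed.

Lemma exchange_tlift U V U' V' W (F : U -> V -> U' -> V' -> W) s t :
  tlift (fun u v => tlift (F u v) t) s = tlift (fun u' v' => tlift (fun u v => F u v u' v') s) t.
Proof.
pose e (Z : vectType k) i := (vbasis {:Z})`_i.
have expand (Z Z' : vectType k) (f : Z -> Z' -> W) (r : tens Z Z') :
    tlift f r = \sum_(ij : 'I__ * 'I__) r ij.1 ij.2 *: f (e Z ij.1) (e Z' ij.2).
  by rewrite /tlift pair_big.
rewrite !expand; under eq_bigr do rewrite expand scaler_sumr.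
rewrite exchange_big; apply: eq_bigr => ij _; rewrite expand scaler_sumr.
by apply: eq_bigr => ij' _; rewrite !scalerA mulrC.
Qed.

Lemma tprodDl U V (u u' : U) (v : V) : (u + u') ⊗ v = u ⊗ v + u' ⊗ v.
Proof. by apply/matrixP => i j; rewrite !mxE linearD mulrDl. Qed.

Lemma tprodDr U V (u : U) (v v' : V) : u ⊗ (v + v') = u ⊗ v + u ⊗ v'.
Proof. by apply/matrixP => i j; rewrite !mxE linearD mulrDr. Qed.

Lemma tprodZl U V a (u : U) (v : V) : (a *: u) ⊗ v = a *: (u ⊗ v).
Proof. by apply/matrixP => i j; rewrite !mxE linearZ mulrA. Qed.

Lemma tprodZr U V a (u : U) (v : V) : u ⊗ (a *: v) = a *: (u ⊗ v).
Proof. by apply/matrixP => i j; rewrite !mxE linearZ mulrCA. Qed.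

Lemma tprodNl U V (u : U) (v : V) : (- u) ⊗ v = - (u ⊗ v).
Proof. by rewrite -scaleN1r tprodZl scaleN1r. Qed.

Lemma tprodNr U V (u : U) (v : V) : u ⊗ (- v) = - (u ⊗ v).
Proof. by rewrite -scaleN1r tprodZr scaleN1r. Qed.

Definition tensE := (tprodDl, tprodDr, tprodZl, tprodZr).

Lemma tmulDl (A B : falgType k) (s s' t : tens A B) :
  tmul (s + s') t = tmul s t + tmul s' t.
Proof. exact: tliftD. Qed.

Lemma tmulZl (A B : falgType k) a (s t : tens A B) : tmul (a *: s) t = a *: tmul s t.
Proof. exact: tliftZ. Qed.

Lemma tmul_suml (A B : falgType k) (I : finType) (P : pred I) (s : I -> tens A B) t :
  tmul (\sum_(i | P i) s i) t = \sum_(i | P i) tmul (s i) t.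
Proof. exact: tlift_sum. Qed.

Lemma tlift_scale U V W (f : U -> V -> W) a t :
  tlift (fun u v => a *: f u v) t = a *: tlift f t.
Proof.
rewrite /tlift scaler_sumr; apply: eq_bigr => i _; rewrite scaler_sumr.
by apply: eq_bigr => j _; rewrite !scalerA mulrC.
Qed.

Lemma tmulZr (A B : falgType k) a (s t : tens A B) : tmul s (a *: t) = a *: tmul s t.
Proof. by rewrite /tmul -tlift_scale; apply: eq_tlift => u v; rewrite tliftZ. Qed.

Lemma tmulDr (A B : falgType k) (s t t' : tens A B) :
  tmul s (t + t') = tmul s t + tmul s t'.
Proof. by rewrite /tmul -tlift_add; apply: eq_tlift => a b; rewrite tliftD. Qed.

Lemma tmul_sumr (A B : falgType k) (I : finType) (P : pred I) s (t : I -> tens A B) :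
  tmul s (\sum_(i | P i) t i) = \sum_(i | P i) tmul s (t i).
Proof.
apply: (big_morph (tmul s)); first exact: tmulDr.
by rewrite -[0 in LHS](scale0r (0 : tens A B)) tmulZr scale0r.
Qed.

Lemma tlift_tmul (A B : falgType k) W (f : A -> B -> W) (s t : tens A B) :
  bilin f ->
  tlift f (tmul s t) = tlift (fun a b => tlift (fun c d => f (a * c) (b * d)) t) s.
Proof.
move=> fbil; have flin : linear (tlift f) by apply: tlift_linear.
rewrite /tmul (linear_tlift _ _ flin); apply: eq_tlift => a b.
by rewrite (linear_tlift _ _ flin); apply: eq_tlift => c d; rewrite tlift_tprod.
Qed.

End Tensors.

(** * Bases indexed by a finite type *)

Section BasisFamily.
Variables (k : fieldType) (I : finType) (U : vectType k) (f : I -> U).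
Hypothesis f_basis : basis_of {:U} [seq f i | i : I].

Let ft : #|I|.-tuple U := [tuple of codom f].

Definition bcoord (i : I) (u : U) : k := coord ft (enum_rank i) u.

Lemma bcoord_linear i : linear (bcoord i : U -> k^o).
Proof. by move=> a u v; rewrite /bcoord linearP. Qed.

Lemma bcoord_sum u : u = \sum_i bcoord i u *: f i.
Proof.
rewrite {1}(coord_basis (f_basis : basis_of _ ft) (memvf u)) (reindex enum_rank); last first.
  by exists enum_val => i _; rewrite ?enum_rankK ?enum_valK.
by apply: eq_bigr => i _; rewrite nth_codom enum_rankK.
Qed.

Lemma bcoord_basis i j : bcoord i (f j) = (i == j)%:R.
Proof.
rewrite /bcoord; have -> : f j = ft`_(enum_rank j).
  by rewrite nth_codom enum_rankK.
rewrite coord_free ?(basis_free (f_basis : basis_of _ ft)) // eq_sym.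
by rewrite (inj_eq (can_inj enum_rankK)).
Qed.

Lemma basis_family_ind (K : U -> Prop) :
  (forall i, K (f i)) -> K 0 -> (forall a u v, K u -> K v -> K (a *: u + v)) ->
  forall u, K u.
Proof.
move=> Kf K0 Klin u; rewrite (bcoord_sum u).
apply: (big_ind K) => // [v w Kv Kw|i _].
  by rewrite -[v]scale1r; apply: Klin.
by rewrite -[X in K X]addr0; apply: Klin.
Qed.

Lemma eq_linear_basis (W : vectType k) (h h' : U -> W) :
  linear h -> linear h' -> (forall i, h (f i) = h' (f i)) -> h =1 h'.
Proof.
move=> hl hl' hh'; apply: basis_family_ind => // [|a u v hu hv].
  have lin0 (p : U -> W) : linear p -> p 0 = 0.
    by move=> pl; rewrite -(hom_of_linearE pl) linear0.
  by rewrite !lin0.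
by rewrite hl hl' hu hv.
Qed.

Lemma basis_ext_linear (W : vectType k) (e : I -> W) :
  linear (fun u => \sum_i bcoord i u *: e i).
Proof.
move=> a u v; rewrite scaler_sumr -big_split; apply: eq_bigr => i _ /=.
by rewrite bcoord_linear scalerDl scalerA.
Qed.

Definition basis_ext (W : vectType k) (e : I -> W) : 'Hom(U, W) :=
  hom_of_linear (basis_ext_linear e).

Lemma basis_extE (W : vectType k) (e : I -> W) i : basis_ext e (f i) = e i.
Proof.
rewrite hom_of_linearE (bigD1 i) //= bcoord_basis eqxx scale1r big1 ?addr0 // => j ji.
by rewrite bcoord_basis (negPf ji) scale0r.
Qed.

End BasisFamily.

(** * Sweedler calculus *)

(** Linearity, in one argument at a time, of expressions that are built from
    products, tensors, scalings and linear maps: distribute, then pull the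
    scalar out of every factor. *)
Ltac lin :=
  repeat lazymatch goal with
    | |- bilin _ => split | |- GRing.linear_for _ _ => fail | |- forall _, _ => intro end;
  let a := fresh in let u := fresh in let v := fresh in
  move=> a u v /=;
  rewrite ?(mulrDl, mulrDr, scalerDr, scalerDl, tprodDl, tprodDr, tprodZl, tprodZr, linearD) /=;
  rewrite ?(=^~ scalerAl, =^~ scalerAr, tprodZl, tprodZr, linearZ) /=;
  rewrite -?(scalerAl, scalerAr) ?(tprodZl, tprodZr, linearZ, tliftD, tliftZ) //=.

Section Hopf.
Variables (k : fieldType) (H : falgType k) (hH : hopf H).
Local Notation Δ := (comul hH).
Local Notation S := (antipode hH).
Local Notation ε := (counit hH).

(** Coassociativity for a trilinear function of h_1, h_2 and h_3. *)
Lemma coassoc (W : vectType k) (F : H -> H -> H -> W) h :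
  (forall b c, linear (fun a => F a b c)) -> (forall a c, linear (fun b => F a b c)) ->
  (forall a b, linear (F a b)) ->
  tlift (fun a t => tlift (F a) (Δ t)) (Δ h) =
  tlift (fun t c => tlift (fun a b => F a b c) (Δ t)) (Δ h).
Proof.
move=> F1 F2 F3; pose L := tlift (fun a (s : tens H H) => tlift (F a) s).
have Llin : linear L by apply: tlift_linear.
have Lbil : bilin (fun a (s : tens H H) => tlift (F a) s).
  by split=> [a|s]; [apply: tlift_linear | apply: tlift_linear_param].
have := congr1 L (comulA hH h); rewrite !linear_tlift //.
under eq_tlift do rewrite /L tlift_tprod //.
move=> ->; apply: eq_tlift => t c; rewrite linear_tlift //; apply: eq_tlift => a b.
by rewrite /L tlift_tprod // tlift_tprod //; split.
Qed.

(** The identity has the antipode as its right convolution inverse, so it may be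
    cancelled: q = q * id * S. *)
Lemma conv_antipode_eq0 (q : 'Hom(H, H)) :
  (forall h, tlift (fun a b => q a * b : H) (Δ h) = 0) -> forall h, q h = 0.
Proof.
move=> qid h; rewrite -{1}(counitr hH h) (linear_tlift (W' := H)) /=; last by lin.
rewrite (eq_tlift (f' := fun a t => tlift (fun b c => q a * (b * S c) : H) (Δ t))); last first.
  move=> a t; rewrite linearZ -(linear_tlift (L := fun u => q a * u)) /=; last by lin.
  by rewrite antipoder -scalerAr mulr1.
rewrite (coassoc (F := fun a b c => q a * (b * S c))) /=; try by lin.
rewrite (eq_tlift (f' := fun _ _ => 0)) => [|t c].
  by rewrite /tlift big1 // => i _; rewrite big1 // => j _; rewrite scaler0.
rewrite (eq_tlift (f' := fun a b => (q a * b) * S c)) => [|a b]; last by rewrite mulrA.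
by rewrite -(linear_tlift (L := fun u => u * S c)) /= ?qid ?mul0r //; lin.
Qed.

Lemma conv_antipode_inj (q q' : H -> H) : linear q -> linear q' ->
  (forall h, tlift (fun a b => q a * b : H) (Δ h) = tlift (fun a b => q' a * b : H) (Δ h)) ->
  q =1 q'.
Proof.
move=> ql ql' qq' h; pose d := hom_of_linear ql - hom_of_linear ql'.
have dE u : d u = q u - q' u by rewrite add_lfunE opp_lfunE !hom_of_linearE.
apply: subr0_eq; rewrite -dE; apply: conv_antipode_eq0 => u.
rewrite (eq_tlift (f' := fun a b => q a * b + -1 *: (q' a * b))) => [|a b].
  by rewrite tlift_add tlift_scale scaleN1r qq' subrr.
by rewrite dE mulrBl scaleN1r.
Qed.

Lemma antipode1 : S 1 = 1.
Proof.
have := antipodel hH 1; rewrite comul1 counit1 scale1r tlift_tprod ?mulr1 //; lin.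
Qed.

End Hopf.

(** * Monomial bases and skew-primitive generators *)

Section Monomials.
Variables (k : fieldType) (n : nat).

Definition mon (T : falgType k) (u : T) (y : 'I_n -> T) (aP : bool * {set 'I_n}) : T :=
  u ^+ aP.1 * En_mon y aP.2.

Lemma En_mon0 (T : falgType k) (y : 'I_n -> T) : En_mon y set0 = 1.
Proof. by rewrite /En_mon big_set0. Qed.

Lemma En_monU1 (T : falgType k) (y : 'I_n -> T) (P : {set 'I_n}) (z : 'I_n) :
  (forall p, p \in P -> (p < z)%N) -> En_mon y (z |: P) = En_mon y P * y z.
Proof. exact: prod_setU1_max. Qed.

Lemma En_mon1 (T : falgType k) (y : 'I_n -> T) i : En_mon y [set i] = y i.
Proof. by rewrite /En_mon big_set1. Qed.

Lemma mon_ind (T : falgType k) (u : T) (y : 'I_n -> T) (K : T -> Prop) :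
  basis_of {:T} [seq mon u y aP | aP : bool * {set 'I_n}] ->
  K 0 -> (forall a s t, K s -> K t -> K (a *: s + t)) -> K 1 ->
  (forall s t, K s -> K t -> K (s * t)) -> K u -> (forall i, K (y i)) -> forall t, K t.
Proof.
move=> basis K0 Klin K1 KM Ku Ky; apply: (basis_family_ind basis) => // -[a P].
apply: (KM); first by case: a.
by rewrite /En_mon; apply: (big_ind K).
Qed.

Lemma anticomm_mon (T : falgType k) (u : T) (y : 'I_n -> T) (P : {set 'I_n}) :
  (forall i, i \in P -> u * y i = - (y i * u)) ->
  u * En_mon y P = (-1) ^+ #|P| *: (En_mon y P * u).
Proof.
elim/set_max_ind: P => [|P z Pz IH] uy; first by rewrite En_mon0 mulr1 mul1r cards0 scale1r.
rewrite En_monU1 // cardsU1 (notin_max Pz) mulrA IH => [|i iP]; last by rewrite uy ?setU1r.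
rewrite -scalerAl -(mulrA _ u) uy ?setU11 // exprD mulN1r scaleNr mulrN scalerN.
by rewrite mulrA.
Qed.

Lemma anticomm_monr (T : falgType k) (u : T) (y : 'I_n -> T) (P : {set 'I_n}) :
  (forall i, i \in P -> u * y i = - (y i * u)) ->
  En_mon y P * u = (-1) ^+ #|P| *: (u * En_mon y P).
Proof. by move=> /anticomm_mon->; rewrite scalerA -exprMn mulrNN mulr1 expr1n scale1r. Qed.

Lemma expr_involution (T : falgType k) (u : T) (a b : bool) :
  u ^+ 2 = 1 -> u ^+ a * u ^+ b = u ^+ (a (+) b).
Proof. by case: a b => [] [] //= u2; rewrite ?mulr1 ?mul1r // -expr2. Qed.

Section SkewPrimitive.
Variables (H T : falgType k) (g : H) (x : 'I_n -> H) (u : T) (y : 'I_n -> T).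
Variable R : T -> tens T H.
Hypotheses (gg : g ^+ 2 = 1) (gx : forall i, g * x i = - (x i * g)).
Hypotheses (R1 : R 1 = 1 ⊗ 1) (RM : forall a b, R (a * b) = tmul (R a) (R b)).
Hypotheses (Ru : R u = u ⊗ g) (Ry : forall i, R (y i) = y i ⊗ g + 1 ⊗ x i).

(** In the product of the y_i ⊗ g + 1 ⊗ x_i choose the first summand for i in F.
    Moving the resulting factors g of the second component to the front, the
    one at f crosses the x_p with p < f, p outside F. This serves both for the
    coproduct of E(n) and for the coaction on a Clifford algebra: the y_i need
    not satisfy any relation. *)
Lemma skew_prod P :
  R (En_mon y P) = \sum_(F : {set 'I_n} | F \subset P)
    (-1) ^+ ninv F (P :\: F) *: (En_mon y F ⊗ mon g x (odd #|F|, P :\: F)).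
Proof.
elim/set_max_ind: P => [|P z Pz IH].
  rewrite En_mon0 R1 (big_pred1 set0) => [|F]; last by rewrite subset0.
  by rewrite ninv0l set0D cards0 /mon /= !En_mon0 scale1r mulr1.
have zP := notin_max Pz.
rewrite En_monU1 // RM Ry tmulDr IH !tmul_suml sum_subsetU1 // addrC.
have zD (F : {set 'I_n}) : F \subset P -> forall p, p \in P :\: F -> (p < z)%N.
  by move=> FP p /setDP[/Pz].
have zF (F : {set 'I_n}) : F \subset P -> forall p, p \in F -> (p < z)%N.
  by move=> /subsetP FP p /FP/Pz.
have zPF (F : {set 'I_n}) : F \subset P -> z \notin P :\: F by rewrite inE (negPf zP) andbF.
congr (_ + _); apply: eq_bigr => F FP; rewrite tmulZl tmulE.
  have -> : (z |: P) :\: F = z |: (P :\: F).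
    apply/setP => p; rewrite !inE; have [->|//] := eqVneq p z.
    by rewrite (contra _ zP) //; apply: subsetP.
  rewrite ninvU1r ?zPF // (ninv_lt (zF _ FP)) add0n mulr1 /mon /= (En_monU1 _ (zD _ FP)).
  by rewrite mulrA.
have zFn := notin_max (zF _ FP).
have -> : (z |: P) :\: (z |: F) = P :\: F.
  by apply/setP => p; rewrite !inE; case: eqVneq => // ->; rewrite (negPf zP) andbF.
rewrite ninvU1l // (ninv_gt (zD _ FP)) (En_monU1 _ (zF _ FP)) cardsU1 zFn add1n.
rewrite /mon /= exprD mulrC -scalerA; congr (_ *: _).
have -> : g ^+ odd #|F| * En_mon x (P :\: F) * g =
    (-1) ^+ #|P :\: F| *: (g ^+ (~~ odd #|F|) * En_mon x (P :\: F)).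
  rewrite -mulrA anticomm_monr // -scalerAr mulrA -[X in _ * X * _]expr1.
  by rewrite (expr_involution _ true) // addbT.
by rewrite tprodZr.
Qed.

Lemma skew_mon a P :
  R (mon u y (a, P)) = \sum_(F : {set 'I_n} | F \subset P)
    (-1) ^+ ninv F (P :\: F) *: (mon u y (a, F) ⊗ mon g x (a (+) odd #|F|, P :\: F)).
Proof.
have Rua : R (u ^+ a) = u ^+ a ⊗ g ^+ a by case: a.
rewrite {1}/mon /= RM Rua skew_prod.
rewrite tmul_sumr; apply: eq_bigr => F FP; rewrite tmulZr tmulE.
by rewrite /mon /= mulrA expr_involution.
Qed.

End SkewPrimitive.
End Monomials.

(** * The Hopf algebra E(n) *)

Section En.
Variables (k : fieldType) (n : nat) (H : falgType k) (hH : hopf H).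
Variables (g : H) (x : 'I_n -> H).
Hypothesis H_En : is_En hH g x.
Local Notation Δ := (comul hH).
Local Notation S := (antipode hH).
Local Notation ε := (counit hH).

Lemma En_mon_basis : basis_of {:H} [seq mon g x aP | aP : bool * {set 'I_n}].
Proof. exact: En_basis H_En. Qed.

Lemma comul_mon a P :
  Δ (mon g x (a, P)) = \sum_(F : {set 'I_n} | F \subset P)
    (-1) ^+ ninv F (P :\: F) *: (mon g x (a, F) ⊗ mon g x (a (+) odd #|F|, P :\: F)).
Proof.
apply: skew_mon; [exact: En_gg H_En | exact: En_gx H_En | exact: comul1
  | exact: comulM | exact: En_comul_g H_En | exact: En_comul_x H_En].
Qed.

Lemma mul_gg : g * g = 1. Proof. by rewrite -expr2 (En_gg H_En). Qed.

(** Both h |-> S(gh)g and S are left convolution inverses of the identity. The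
    same argument gives the next lemma. *)
Lemma antipode_gl h : S (g * h) = S h * g.
Proof.
suff: S (g * h) * g = S h by move=> <-; rewrite -mulrA mul_gg mulr1.
apply: (conv_antipode_inj (hH := hH) (q := fun h => S (g * h) * g : H)) => [||{}h]; try by lin.
rewrite antipodel; have := antipodel hH (g * h).
rewrite comulM counitM (En_counit_g H_En) mul1r => <-; rewrite tlift_tmul; last by lin.
rewrite (En_comul_g H_En) tlift_tprod; last by split=> ?; apply: tlift_linear_param => *; lin.
by apply: eq_tlift => a b; rewrite mulrA.
Qed.

Lemma antipode_xl i h : S (x i * h) = S h * (g * x i).
Proof.
suff: S (x i * h) * g = S h * - x i.
  move=> /(congr1 (fun u => u * g)); rewrite -mulrA mul_gg mulr1 => ->.
  by rewrite (En_gx H_En) !mulrN mulNr mulrA.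
apply: (conv_antipode_inj (hH := hH) (q := fun h => S (x i * h) * g : H)
  (q' := fun h => S h * - x i : H)) => [||{}h]; try by lin.
have := antipodel hH (x i * h).
rewrite comulM counitM (En_counit_x H_En) mul0r scale0r tlift_tmul; last by lin.
rewrite (En_comul_x H_En) tliftD !tlift_tprod; try by split=> ?; apply: tlift_linear_param => *; lin.
move/eqP; rewrite addr_eq0 => /eqP sum0.
transitivity (tlift (fun a b : H => S (x i * a) * (g * b) : H) (Δ h)).
  by apply: eq_tlift => a b; rewrite mulrA.
rewrite [LHS]sum0 -scaleN1r -tlift_scale; apply: eq_tlift => a b.
by rewrite mul1r scaleN1r mulrN mulNr mulrA.
Qed.

(** By induction on the left factor, from the two lemmas above for left factors
    that are generators. *)
Lemma antipodeM a b : S (a * b) = S b * S a.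
Proof.
move: a b; apply: (mon_ind En_mon_basis) => [b|a s t IHs IHt b|b|s t IHs IHt b|b|i b].
- by rewrite mul0r linear0 mulr0.
- by rewrite mulrDl -scalerAl linearP /= IHs IHt linearP mulrDr -scalerAr.
- by rewrite mul1r antipode1 mulr1.
- by rewrite -mulrA IHs IHt IHs mulrA.
- by rewrite antipode_gl (En_antipode_g H_En).
- by rewrite antipode_xl (En_antipode_x H_En).
Qed.

Section Invariant.
Variables (V : vectType k) (BA : 'Hom(tens H H, V)).

(** In one direction insert h_1 ⊗ h_2 S(h_3) for h ⊗ 1, in the other use that S
    reverses products. *)
Lemma casimir_invariantP :
  (forall h h' h'' : H, tlift (fun h1 h2 : H => BA ((h1 * h') ⊗ (h2 * h''))) (Δ h) =
     ε h *: BA (h' ⊗ h'')) <->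
  (forall h h' : H, BA (h ⊗ h') = BA (1 ⊗ (S h * h'))).
Proof.
split=> [inv h h'|BAE h h' h''].
  rewrite -{1}(counitr hH h).
  transitivity (tlift (fun a t => tlift (fun b c => BA (a ⊗ (b * S c * h'))) (Δ t)) (Δ h)).
    have Llin : linear (fun u => BA (u ⊗ h')) by lin.
    rewrite (linear_tlift _ _ Llin); apply: eq_tlift => a t; rewrite tprodZl linearZ /=.
    transitivity (BA (a ⊗ (ε t *: 1 * h'))); first by rewrite -scalerAl mul1r tprodZr linearZ.
    rewrite -antipoder; have L'lin : linear (fun u => BA (a ⊗ (u * h'))) by lin.
    by rewrite (linear_tlift _ _ L'lin).
  rewrite (coassoc hH (F := fun a b c => BA (a ⊗ (b * S c * h')))) /=; try by lin.
  transitivity (tlift (fun t c => ε t *: BA (1 ⊗ (S c * h'))) (Δ h)).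
    apply: eq_tlift => t c; rewrite -inv; apply: eq_tlift => a b.
    by rewrite mulr1 mulrA.
  rewrite -{2}(counitl hH h); have Llin : linear (fun u => BA (1 ⊗ (S u * h'))) by lin.
  by rewrite (linear_tlift _ _ Llin); apply: eq_tlift => t c; rewrite !linearZ /= -scalerAl tprodZr linearZ.
transitivity (BA (1 ⊗ (S h' * (ε h *: 1) * h''))).
  have Llin : linear (fun u => BA (1 ⊗ (S h' * u * h''))) by lin.
  rewrite -antipodel (linear_tlift _ _ Llin); apply: eq_tlift => a b.
  by rewrite BAE antipodeM !mulrA.
by rewrite -scalerAr mulr1 -scalerAl tprodZr linearZ /= -BAE.
Qed.

End Invariant.

Section Morphism.
Variables (A : falgType k) (cA : comodule_algebra hH A) (BA : 'Hom(tens H H, A)).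

(** The morphism condition for a single element of A, so that it can be shown to
    define a subalgebra. *)
Definition morphism_at (a : A) : Prop := forall h h' : H,
  tlift (fun (a0 : A) (a12 : H) =>
      tlift (fun a1 a2 : H => a0 * BA ((h * a1) ⊗ (h' * a2)) : A) (Δ a12) : A)
    (coact cA a) = BA (h ⊗ h') * a.

Lemma morphism_bilin h h' :
  bilin (fun (a0 : A) (a12 : H) =>
    tlift (fun a1 a2 : H => a0 * BA ((h * a1) ⊗ (h' * a2)) : A) (Δ a12) : A).
Proof.
split=> [a0|a12]; last by apply: tlift_linear_param; lin.
by move=> a u v; rewrite linearP tlift_linear.
Qed.

Lemma morphism_at0 : morphism_at 0.
Proof. by move=> h h'; rewrite linear0 tlift0 mulr0. Qed.

Lemma morphism_atD a s t : morphism_at s -> morphism_at t -> morphism_at (a *: s + t).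
Proof.
by move=> ms mt h h'; rewrite linearP tlift_linear ms mt mulrDr -scalerAr.
Qed.

Lemma morphism_at1 : morphism_at 1.
Proof.
move=> h h'; rewrite coact1 tlift_tprod; last exact: morphism_bilin.
by rewrite comul1 tlift_tprod ?mul1r ?mulr1 //; lin.
Qed.

Lemma morphism_atM s t : morphism_at s -> morphism_at t -> morphism_at (s * t).
Proof.
move=> ms mt h h'; rewrite coactM tlift_tmul; last exact: morphism_bilin.
rewrite mulrA -ms; have Llin : linear (fun u : A => u * t) by lin.
rewrite (linear_tlift _ _ Llin); apply: eq_tlift => s0 s12.
rewrite (linear_tlift _ _ Llin).
transitivity (tlift (fun t0 t12 => tlift (fun s1 s2 => tlift (fun t1 t2 =>
    s0 * (t0 * BA ((h * s1 * t1) ⊗ (h' * s2 * t2))) : A) (Δ t12) : A) (Δ s12) : A) (coact cA t)).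
  apply: eq_tlift => t0 t12; rewrite comulM tlift_tmul; last by lin.
  by apply: eq_tlift => s1 s2; apply: eq_tlift => t1 t2; rewrite !mulrA.
rewrite exchange_tlift; apply: eq_tlift => s1 s2.
have L'lin : linear (fun u : A => s0 * u) by lin.
rewrite -mulrA -mt (linear_tlift _ _ L'lin); apply: eq_tlift => t0 t12.
by rewrite (linear_tlift _ _ L'lin).
Qed.

End Morphism.

End En.

(** * Subsets of {0, ..., n} *)

Section IndexSets.
Variable n : nat.
Implicit Types (P Q F : {set 'I_n}) (R : {set 'I_n.+1}) (i z : 'I_n).

Local Notation up i := (lift ord0 i).

Definition liftset P : {set 'I_n.+1} := [set up i | i in P].

(** The set of factors of G^a X_P. *)
Definition Rset (aP : bool * {set 'I_n}) : {set 'I_n.+1} :=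
  if aP.1 then Qbar aP.2 else liftset aP.2.

Definition Rset_inv R : bool * {set 'I_n} := (ord0 \in R, [set i | up i \in R]).

Lemma mem_liftset i P : (up i \in liftset P) = (i \in P).
Proof. exact/mem_imset/lift_inj. Qed.

Lemma ord0_liftset P : ord0 \notin liftset P.
Proof. by apply/imsetP => -[i _ /eqP]; rewrite (negPf (neq_lift _ _)). Qed.

Lemma QbarE P : Qbar P = ord0 |: liftset P. Proof. by []. Qed.

Lemma mem_Qbar i P : (up i \in Qbar P) = (i \in P).
Proof. by rewrite QbarE in_setU1 mem_liftset eq_sym (negPf (neq_lift _ _)). Qed.

Lemma ord0_Rset aP : (ord0 \in Rset aP) = aP.1.
Proof. by case: aP => [] [] P; rewrite /Rset /= ?setU11 ?(negPf (ord0_liftset _)). Qed.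

Lemma mem_Rset i aP : (up i \in Rset aP) = (i \in aP.2).
Proof. by rewrite /Rset; case: ifP => _; rewrite ?mem_Qbar ?mem_liftset. Qed.

Lemma eq_ordS_set R R' :
  (ord0 \in R) = (ord0 \in R') -> (forall i, (up i \in R) = (up i \in R')) -> R = R'.
Proof. by move=> R0 RS; apply/setP => r; case: (unliftP ord0 r) => [i|] ->. Qed.

Lemma RsetK : cancel Rset Rset_inv.
Proof.
move=> aP; rewrite /Rset_inv ord0_Rset [aP in RHS]surjective_pairing; congr (_, _).
by apply/setP => i; rewrite inE mem_Rset.
Qed.

Lemma Rset_invK : cancel Rset_inv Rset.
Proof.
move=> R; apply: eq_ordS_set => [|i]; first by rewrite ord0_Rset.
by rewrite mem_Rset inE.
Qed.

Lemma Rset_false P : Rset (false, P) = liftset P. Proof. by []. Qed.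

Lemma Rset_true P : Rset (true, P) = Qbar P. Proof. by []. Qed.

Lemma card_liftset P : #|liftset P| = #|P|.
Proof. exact/card_imset/lift_inj. Qed.

Lemma card_Qbar P : #|Qbar P| = #|P|.+1.
Proof. by rewrite QbarE cardsU1 ord0_liftset card_liftset. Qed.

Lemma card_Rset aP : #|Rset aP| = (aP.1 + #|aP.2|)%N.
Proof. by rewrite /Rset; case: aP.1; rewrite ?card_Qbar ?card_liftset. Qed.

Lemma liftsetU1 z P : liftset (z |: P) = up z |: liftset P.
Proof.
apply: eq_ordS_set => [|i]; first by rewrite in_setU1 (negPf (neq_lift _ _)) !(negPf (ord0_liftset _)).
by rewrite in_setU1 !mem_liftset in_setU1 (inj_eq lift_inj).
Qed.

Lemma QbarU1 z P : Qbar (z |: P) = up z |: Qbar P.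
Proof. by rewrite !QbarE liftsetU1 setUCA. Qed.

Lemma liftsetD1 z P : liftset (P :\ z) = liftset P :\ up z.
Proof.
apply: eq_ordS_set => [|i]; first by rewrite in_setD1 !(negPf (ord0_liftset _)) andbF.
by rewrite in_setD1 !mem_liftset in_setD1 (inj_eq lift_inj).
Qed.

Lemma QbarD1 z P : Qbar (P :\ z) = Qbar P :\ up z.
Proof.
apply: eq_ordS_set => [|i]; first by rewrite in_setD1 neq_lift !setU11.
by rewrite in_setD1 !mem_Qbar in_setD1 (inj_eq lift_inj).
Qed.

Lemma lt_up z P r : (forall p, p \in P -> (p < z)%N) -> r \in Qbar P -> (r < up z)%N.
Proof.
move=> Pz; case: (unliftP ord0 r) => [i|] ->; last by rewrite lift0.
by rewrite mem_Qbar => /Pz; rewrite !lift0 ltnS.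
Qed.

Lemma lt_up_liftset z P r :
  (forall p, p \in P -> (p < z)%N) -> r \in liftset P -> (r < up z)%N.
Proof. by move=> Pz rP; apply: (lt_up Pz); rewrite QbarE setU1r. Qed.

Lemma sum_liftset (V : nmodType) P (f : 'I_n.+1 -> V) :
  \sum_(r in liftset P) f r = \sum_(i in P) f (up i).
Proof. by rewrite big_imset //= => i i' _ _; apply: lift_inj. Qed.

Lemma sum_Qbar (V : nmodType) P (f : 'I_n.+1 -> V) :
  \sum_(r in Qbar P) f r = f ord0 + \sum_(i in P) f (up i).
Proof. by rewrite QbarE big_setU1 ?ord0_liftset //= sum_liftset. Qed.

Lemma card_gt_liftset i P :
  #|[set r in liftset P | (up i < r)%N]| = #|[set p in P | (i < p)%N]|.
Proof.
rewrite -[RHS]card_liftset; congr #|pred_of_set _|; apply: eq_ordS_set => [|j].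
  by rewrite inE !(negPf (ord0_liftset _)).
by rewrite mem_liftset !inE mem_liftset !lift0 ltnS.
Qed.

Lemma card_gt_Qbar i P :
  #|[set r in Qbar P | (up i < r)%N]| = #|[set p in P | (i < p)%N]|.
Proof.
rewrite -[RHS]card_liftset; congr #|pred_of_set _|; apply: eq_ordS_set => [|j].
  by rewrite inE (negPf (ord0_liftset _)) andbF.
by rewrite mem_liftset in_set mem_Qbar in_set !lift0 ltnS.
Qed.

Lemma card_gt0_Qbar P : #|[set r in Qbar P | ((ord0 : 'I_n.+1) < r)%N]| = #|P|.
Proof.
rewrite -[RHS]card_liftset; congr #|pred_of_set _|; apply: eq_ordS_set => [|j].
  by rewrite inE ltnn andbF (negPf (ord0_liftset _)).
by rewrite mem_liftset in_set mem_Qbar lift0 andbT.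
Qed.

Lemma Qminus_Rset a Q F : F \subset Q -> Qminus Q (Rset (a, Q :\: F)) = F.
Proof.
move=> FQ; apply/setP => i; rewrite inE mem_Rset /= in_setD.
by case: (boolP (i \in F)) => [/(subsetP FQ)->|iF] //=; case: (i \in Q).
Qed.

(** The subsets of Qbar Q of a given parity correspond to the subsets F of Q:
    the parity decides whether the complement of F is completed by 0. *)
Lemma sum_Qbar_parity (V : nmodType) (e : bool) Q (f : {set 'I_n.+1} -> V) :
  \sum_(R : {set 'I_n.+1} | (R \subset Qbar Q) && (odd #|R| == e (+) odd #|Q|)) f R =
  \sum_(F : {set 'I_n} | F \subset Q) f (Rset (e (+) odd #|F|, Q :\: F)).
Proof.
rewrite (reindex_onto (fun F => Rset (e (+) odd #|F|, Q :\: F)) (Qminus Q)) /=.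
  apply: eq_bigl => F; apply/andP/idP => [[_ /eqP<-]|FQ].
    by apply/subsetP => i; rewrite inE => /andP[].
  rewrite Qminus_Rset // eqxx; split=> //; apply/andP; split.
    apply/subsetP => r; case: (unliftP ord0 r) => [i|] -> //; last by rewrite setU11.
    by rewrite mem_Rset mem_Qbar => /setDP[].
  rewrite card_Rset /= cardsD (setIidPr FQ) oddD oddb oddB ?subset_leq_card //.
  by rewrite [odd #|Q| (+) _]addbC addbA addbK.
move=> R /andP[RQ /eqP oddR].
have RE : R = Rset (ord0 \in R, Q :\: Qminus Q R).
  apply: eq_ordS_set => [|i]; first by rewrite ord0_Rset.
  rewrite mem_Rset /= !inE; case: (boolP (up i \in R)) => [iR|iR]; last by case: (i \in Q).
  by rewrite -mem_Qbar (subsetP RQ).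
rewrite [RHS]RE; congr (Rset (_, _)).
have FQ : Qminus Q R \subset Q by apply/subsetP => i; rewrite inE => /andP[].
move: oddR; rewrite {1}RE card_Rset /= cardsD (setIidPr FQ) oddD oddb oddB ?subset_leq_card //.
by case: (ord0 \in R) (odd #|Q|) (odd #|Qminus Q R|) e => [] [] [] [].
Qed.

(** Only the complements of singletons leave a one-element set. *)
Lemma sum_coset1 (V : nmodType) Q (f : {set 'I_n} -> 'I_n -> V) :
  \sum_(F : {set 'I_n} | F \subset Q)
     \sum_(i in Q :\: F) (if (Q :\: F) :\ i == set0 then f F i else 0) =
  \sum_(i in Q) f (Q :\ i) i.
Proof.
rewrite (exchange_big_dep (mem Q)) /= => [|F i _ /setDP[]//].
apply: eq_bigr => i iQ; rewrite (bigD1 (Q :\ i)) /=; last first.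
  by rewrite subD1set setDDr setDv set0U inE iQ set11.
rewrite [Q :\: (Q :\ i)]setDDr setDv set0U.
have -> : (Q :&: [set i]) :\ i = set0 by apply/setP => q; rewrite !inE; case: eqVneq => //=; rewrite andbF.
rewrite eqxx big1 ?addr0 // => F /andP[/andP[FQ iF] FQi].
case: eqP => // QF0; case/eqP: FQi; apply/setP => q; rewrite !inE.
have /setP/(_ q) := QF0; rewrite !inE; move: iF; rewrite inE => /andP[iF _].
have [->|_] := eqVneq q i; first by rewrite (negPf iF).
case: (boolP (q \in F)) => [/(subsetP FQ)->//|_] /=; by [].
Qed.

End IndexSets.

(** * Coefficients of antisymmetrized products *)

Section Coefficients.
Variables (k : fieldType) (n : nat).
Hypothesis two_neq0 : 2%:R != 0 :> k.
Variables (gamma : 'I_n -> k) (lambda : 'I_n -> 'I_n -> k).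
Implicit Types (P Q F : {set 'I_n}) (z i : 'I_n).
Local Notation up i := (lift ord0 i).

Definition block_weight (P : {set 'I_n.+1}) : k :=
  if enum P is [:: i; j] then lambda0 gamma lambda i j else 0.

Lemma lambda0_0 z : lambda0 gamma lambda ord0 (up z) = gamma z.
Proof. by rewrite /lambda0 unlift_none liftK. Qed.

Lemma lambda0_up i z : lambda0 gamma lambda (up i) (up z) = lambda i z.
Proof. by rewrite /lambda0 !liftK. Qed.

Lemma block_weight2 (r s : 'I_n.+1) : (r < s)%N ->
  block_weight [set r; s] = lambda0 gamma lambda r s.
Proof.
move=> rs; rewrite /block_weight setUC enum_setU1_max ?enum_set1 //.
by move=> p; rewrite inE => /eqP->.
Qed.

(** The value on g x_F of the functional that corresponds to
    g x_Q |-> G /\ X_Q: the constant coefficient of the antisymmetrized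
    product, or its coefficient at G, whichever has the right parity. *)
Definition wedge_coef F : k :=
  (- 2%:R^-1) ^+ (#|F|.+1)./2 * pfaffian block_weight (Rset (odd #|F|, F)).

Lemma wedge_coef0 : wedge_coef set0 = 1.
Proof.
rewrite /wedge_coef cards0 expr0 mul1r /Rset /=.
suff -> : liftset set0 = set0 :> {set 'I_n.+1} by apply: pfaffian0.
by rewrite /liftset imset0.
Qed.

(** Expansion of the Pfaffian along the row of z. Adding z to Q raises the power
    of -1/2 by one, which absorbs the factor 2. *)
Lemma wedge_coef_rec Q z : (forall q, q \in Q -> (q < z)%N) ->
  2%:R * wedge_coef (z |: Q) =
  - ((~~ odd #|Q|)%:R * gamma z * wedge_coef Q +
     \sum_(i in Q) (-1) ^+ #|[set q in Q | (i < q)%N]| * lambda i z * wedge_coef (Q :\ i)).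
Proof.
move=> Qz; have zQ := notin_max Qz; rewrite /wedge_coef cardsU1 zQ add1n [odd _.+1]/=.
have cardD i : i \in Q -> #|Q| = #|Q :\ i|.+1 by move=> iQ; rewrite (cardsD1 i) iQ.
have evenhalf m : ~~ odd m -> (m.+1./2 = m./2)%N by move=> ?; lia.
have half2 : (- 2%:R^-1) * 2%:R = -1 :> k by rewrite mulNr mulVf.
case: (boolP (odd #|Q|)) => oddQ.
  have -> : (#|Q|.+2./2 = ((#|Q|).-1./2).+1)%N by lia.
  rewrite !mul0r add0r Rset_false liftsetU1 pfaffian_expand; last first.
    by move=> r; apply: lt_up_liftset.
  rewrite sum_liftset mulrA exprSr mulrCA [2%:R * _]mulrC half2 mulrN1 mulNr mulr_sumr.
  congr (- _); apply: eq_bigr => i iQ.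
  have oddD : ~~ odd #|Q :\ i| by move: oddQ; rewrite (cardD i iQ).
  rewrite (negPf oddD) Rset_false liftsetD1 card_gt_liftset block_weight2 ?lambda0_up; last first.
    by apply: (lt_up_liftset Qz); rewrite mem_liftset.
  rewrite evenhalf // (cardD i iQ) /=; ring.
have -> : (#|Q|.+2./2 = (#|Q|./2).+1)%N by lia.
rewrite mul1r Rset_true Rset_false QbarU1 pfaffian_expand; last first.
  by move=> r; apply: lt_up.
rewrite sum_Qbar mulrA exprSr mulrCA [2%:R * _]mulrC half2 mulrN1 mulNr mulrDr [_ * \sum_(i in Q) _]mulr_sumr.
congr (- (_ + _)).
  rewrite card_gt0_Qbar -signr_odd (negPf oddQ) expr0 mul1r block_weight2 // lambda0_0.
  rewrite QbarE setU1K ?ord0_liftset // evenhalf //; ring.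
apply: eq_bigr => i iQ.
have oddD : odd #|Q :\ i| by move: oddQ; rewrite (cardD i iQ) negbK.
rewrite oddD Rset_true QbarD1 card_gt_Qbar block_weight2 ?lambda0_up; last first.
  by apply: (lt_up Qz); rewrite mem_Qbar.
rewrite -(cardD i iQ); ring.
Qed.

Lemma ninv_Rset (a b : bool) P F :
  ninv (Rset (a, P)) (Rset (b, F)) = (ninv P F + b * #|P|)%N.
Proof.
have ninv_lift : ninv (liftset P) (liftset F) = ninv P F.
  rewrite /ninv sum_liftset; apply: eq_bigr => p _; rewrite sum_liftset.
  by apply: eq_bigr => f _; rewrite !lift0 ltnS.
have right0 : ninv (liftset P) [set ord0] = #|P|.
  rewrite ninv_set1r -[RHS]card_liftset; congr #|pred_of_set _|.
  apply: eq_ordS_set => [|i]; first by rewrite !inE !(negPf (ord0_liftset _)).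
  by rewrite in_set lift0 andbT.
have left0 R : ninv [set ord0] R = 0%N :> nat.
  by rewrite /ninv big_set1 big1.
have liftR : ninv (liftset P) (Rset (b, F)) = (ninv P F + b * #|P|)%N.
  rewrite /Rset; case: b => /=; last by rewrite ninv_lift addn0.
  by rewrite QbarE ninvU1r ?ord0_liftset // right0 ninv_lift mul1n addnC.
rewrite {1}/Rset; case: a => //=.
by rewrite QbarE ninvU1l ?ord0_liftset // left0 liftR.
Qed.

Lemma Qbar_minus_Rset (a : bool) Q F : F \subset Q ->
  Qbar Q :\: Rset (a, Q :\: F) = Rset (~~ a, F).
Proof.
move=> FQ; apply: eq_ordS_set => [|i].
  by rewrite in_setD !ord0_Rset setU11 andbT.
rewrite in_setD !mem_Rset mem_Qbar in_setD /=.
by case: (boolP (i \in F)) => [/(subsetP FQ)->|_] //=; case: (i \in Q).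
Qed.

(** The two signs agree because R and Qbar Q minus R are complementary: the
    inversions between Q minus F and F and those between F and Q minus F add up
    to |F| |Q minus F|, and the index 0 contributes the remaining parity. *)
Lemma matching_coefE (mu : k) Q F (R := Rset (~~ odd #|F|, Q :\: F)) : F \subset Q ->
  mu / 2%:R ^+ (#|Qbar Q|./2) *
    ((-1) ^+ (Spos R (Qbar Q) + (#|Qbar Q| - #|R|)./2) * 2%:R ^+ (#|R|./2) *
     \sum_(PP in pi2 (Qbar Q :\: R))
        matching_sgn k (Qbar Q :\: R) PP * Lambda gamma lambda PP) =
  (-1) ^+ ninv F (Q :\: F) * (mu * wedge_coef F).
Proof.
move=> FQ; rewrite -/(pfaffian block_weight (Qbar Q :\: R)).
have RQ : R \subset Qbar Q.
  apply/subsetP => r; case: (unliftP ord0 r) => [i|] ->; last by rewrite setU11.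
  by rewrite mem_Rset mem_Qbar => /setDP[].
rewrite SposE // Qbar_minus_Rset // negbK ninv_Rset /wedge_coef.
have leFQ := subset_leq_card FQ; have cardQF : #|Q :\: F| = (#|Q| - #|F|)%N.
  by rewrite cardsD (setIidPr FQ).
have ninvC := ninv_addC (_ : [disjoint F & Q :\: F]).
have {}ninvC : (ninv F (Q :\: F) + ninv (Q :\: F) F = #|F| * #|Q :\: F|)%N.
  by apply: ninvC; rewrite disjoints_subset; apply/subsetP => i iF; rewrite !inE iF.
have cR : #|R| = (~~ odd #|F| + (#|Q| - #|F|))%N by rewrite card_Rset /= cardQF.
have -> : ((#|Qbar Q| - #|R|)./2 = #|F|.+1./2)%N by rewrite card_Qbar cR; lia.
have -> : (#|Qbar Q|./2 = #|R|./2 + #|F|.+1./2)%N by rewrite card_Qbar cR; lia.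
have -> : (-1) ^+ (ninv (Q :\: F) F + odd #|F| * #|Q :\: F| + #|F|.+1./2) =
    (-1) ^+ ninv F (Q :\: F) * (-1) ^+ #|F|.+1./2 :> k.
  rewrite -exprD -signr_odd -[in RHS]signr_odd; congr (_ ^+ _); congr nat_of_bool.
  have := congr1 odd ninvC; rewrite !oddD !oddM oddb.
  by case: (odd (ninv F _)) (odd (ninv _ F)) (odd #|F|) (odd #|_ :\: F|) => [] [] [] [].
have -> m : (- 2%:R^-1) ^+ m = (-1) ^+ m * (2%:R ^+ m)^-1 :> k.
  by rewrite -[in LHS]mulN1r exprMn exprVn.
rewrite exprD.
have unit2 m : 2%:R ^+ m != 0 :> k by rewrite expf_neq0.
have := unit2 (#|R|./2); have := unit2 (#|F|.+1./2).
move: (2%:R ^+ (#|F|.+1./2)) (2%:R ^+ (#|R|./2)) => u v u0 v0.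
by field; rewrite u0 v0.
Qed.

End Coefficients.

(** * Clifford algebras as comodules *)

Lemma bilin_scale (k : fieldType) (U V W : vectType k) (f : U -> k^o) (L : V -> W) :
  linear f -> linear L -> bilin (fun u v => (f u : k) *: L v).
Proof.
move=> flin Llin; split=> [u|v] a s t; last by rewrite flin scalerDl scalerA.
by rewrite Llin scalerDr !scalerA mulrC.
Qed.

(** Moving u to the right through the product, the crossing of y_i contributes
    the scalar c_i in place of y_i, with the sign of the factors already crossed. *)
Lemma contraction_mon (k : fieldType) (m : nat) (T : falgType k) (u : T) (y : 'I_m -> T)
    (c : 'I_m -> k) (P : {set 'I_m}) :
  (forall i, i \in P -> u * y i + y i * u = (c i)%:A) ->
  u * En_mon y P = (-1) ^+ #|P| *: (En_mon y P * u) +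
    \sum_(i in P) ((-1) ^+ #|[set p in P | (p < i)%N]| * c i) *: En_mon y (P :\ i).
Proof.
elim/set_max_ind: P => [|P z Pz IH] uy.
  by rewrite En_mon0 mulr1 mul1r cards0 scale1r big_set0 addr0.
have zP := notin_max Pz; have uz := uy z (setU11 _ _).
rewrite En_monU1 // mulrA IH => [|i iP]; last by rewrite uy ?setU1r.
rewrite mulrDl -scalerAl -[_ * u * _]mulrA -(addrK (y z * u) (u * y z)) uz.
rewrite big_setU1 //= cardsU1 zP add1n exprS mulN1r scaleNr.
rewrite mulrBr scalerBr -addrA addrC -addrA; congr (- (_ *: _) + _); first by rewrite mulrA.
rewrite addrC; congr (_ + _).
  rewrite -scalerAr mulr1 scalerA setU1K // -ninv_set1l.
  have -> : ninv [set z] (z |: P) = #|P|.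
    by rewrite ninvU1r // (ninv_gt Pz) /ninv !big_set1 ltnn.
  by [].
rewrite mulr_suml; apply: eq_bigr => i iP; rewrite -scalerAl.
have iz : i != z by apply: contraNneq zP => <-.
have -> : (z |: P) :\ i = z |: (P :\ i).
  by apply/setP => p; rewrite !inE; case: eqVneq => // ->; rewrite (negPf iz).
rewrite En_monU1 => [|p /setD1P[_ /Pz]//]; congr ((_ ^+ _ * _) *: _).
congr #|pred_of_set _|; apply/setP => p; rewrite !inE; case: eqVneq => //= ->.
by rewrite (negPf zP) ltnNge ltnW // Pz.
Qed.

Section Clifford.
Variables (k : fieldType) (n : nat) (H : falgType k) (hH : hopf H).
Variables (g : H) (x : 'I_n -> H).
Hypothesis H_En : is_En hH g x.
Variables (alpha : k) (beta gamma : 'I_n -> k) (lambda : 'I_n -> 'I_n -> k).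
Variables (A : falgType k) (G : A) (X : 'I_n -> A).
Hypothesis A_Cl : is_Cl alpha beta gamma lambda G X.
Variable cA : comodule_algebra hH A.
Hypothesis cA_canonical : canonical_coaction g x cA G X.

Local Notation Δ := (comul hH).
Local Notation ρ := (coact cA).
Implicit Types (P Q F : {set 'I_n}) (b : 'Hom(H, A)).

Lemma Cl_mon_Rset aP : Cl_mon G X (Rset aP) = mon G X aP.
Proof.
have genS i : Cl_gen G X (lift ord0 i) = X i by rewrite /Cl_gen liftK.
have gen0 : Cl_gen G X ord0 = G by rewrite /Cl_gen unlift_none.
case: aP => a P; elim/set_max_ind: P => [|P z Pz IH].
  have lift0 : liftset set0 = set0 :> {set 'I_n.+1} by rewrite /liftset imset0.
  rewrite /mon /= En_mon0 mulr1; case: a; rewrite ?Rset_true ?Rset_false ?QbarE lift0.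
    by rewrite setU0 /Cl_mon big_set1 gen0.
  by rewrite /Cl_mon big_set0.
have PzR r : r \in Rset (a, P) -> (r < lift ord0 z)%N.
  by case: (a); [apply: lt_up | apply: lt_up_liftset].
have -> : Rset (a, z |: P) = lift ord0 z |: Rset (a, P).
  by case: (a); rewrite ?Rset_true ?Rset_false ?QbarU1 ?liftsetU1.
by rewrite /Cl_mon (prod_setU1_max _ PzR) genS -/(Cl_mon G X _) IH /mon /= En_monU1 // mulrA.
Qed.

Lemma Cl_mon_basis : basis_of {:A} [seq mon G X aP | aP : bool * {set 'I_n}].
Proof.
have perm_bases : perm_eq [seq mon G X aP | aP : bool * {set 'I_n}] 
    [seq Cl_mon G X R | R : {set 'I_n.+1}].
  have -> : [seq mon G X aP | aP : bool * {set 'I_n}] =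
      map (Cl_mon G X) (map (@Rset n) (enum {: bool * {set 'I_n}})).
    by rewrite -map_comp; apply: eq_map => aP; rewrite /= Cl_mon_Rset.
  apply: perm_map.
  apply: uniq_perm; rewrite ?enum_uniq ?(map_inj_uniq (can_inj (@RsetK n))) ?enum_uniq //.
  by move=> R; rewrite mem_enum inE -(Rset_invK R) map_f ?mem_enum.
by rewrite (perm_basis _ perm_bases); apply: Cl_basis A_Cl.
Qed.

Lemma coact_mon a P :
  ρ (mon G X (a, P)) = \sum_(F : {set 'I_n} | F \subset P)
    (-1) ^+ ninv F (P :\: F) *: (mon G X (a, F) ⊗ mon g x (a (+) odd #|F|, P :\: F)).
Proof.
case: cA_canonical => rhoG rhoX.
apply: skew_mon; [exact: En_gg H_En | exact: En_gx H_En | exact: coact1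
  | exact: coactM | exact: rhoG | exact: rhoX].
Qed.

(** ** Colinear maps *)

(** The isomorphism of comodules j of the introduction. *)
Definition mon_iso : 'Hom(H, A) := basis_ext (mon g x) (mon G X).
Local Notation j := mon_iso.

Lemma mon_isoE aP : j (mon g x aP) = mon G X aP.
Proof. exact/basis_extE/(En_mon_basis H_En). Qed.

(** The functional π = ε j^-1 of the introduction. *)
Definition const_coef : 'Hom(A, k^o) :=
  basis_ext (mon G X) (fun aP => (aP.2 == set0)%:R : k^o).
Local Notation π := const_coef.

Lemma const_coef_linear : linear π.
Proof. by move=> a u v; rewrite linearP. Qed.

Lemma const_coef_sum (I : finType) (P : pred I) (c : I -> k) (a : I -> A) :
  π (\sum_(i | P i) c i *: a i) = \sum_(i | P i) c i * π (a i).
Proof. by rewrite linear_sum; apply: eq_bigr => i _; rewrite linearZ. Qed.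

Lemma const_coefD (a c : A) : π (a + c) = π a + π c.
Proof. exact: linearD. Qed.

Lemma const_coefZ r (a : A) : π (r *: a) = r * π a.
Proof. exact: linearZ. Qed.

Lemma const_coefN (a : A) : π (- a) = - π a.
Proof. exact: linearN. Qed.

Lemma const_coef_mon a P : π (mon G X (a, P)) = (P == set0)%:R.
Proof. exact: (basis_extE Cl_mon_basis). Qed.

Lemma subset_minus_eq0 P F : F \subset P -> (P :\: F == set0) = (F == P).
Proof. by move=> FP; rewrite setD_eq0 eqEsubset FP. Qed.

Lemma coact_mon_iso h : ρ (j h) = tlift (fun h1 h2 => j h1 ⊗ h2) (Δ h).
Proof.
move: h; apply: (eq_linear_basis (En_mon_basis H_En)).
- by move=> a u v; rewrite !linearP.
- by move=> a u v; rewrite linearP tlift_linear.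
case=> a P; rewrite mon_isoE coact_mon comul_mon // tlift_sum; apply: eq_bigr => F _.
by rewrite tliftZ tlift_tprod ?mon_isoE //; lin.
Qed.

Lemma const_coef_coact (a : A) : tlift (fun a0 a1 => (π a0 : k) *: j a1) (ρ a) = a.
Proof.
move: a; apply: (eq_linear_basis Cl_mon_basis) => //.
  by move=> a u v; rewrite linearP tlift_linear.
case=> a P; rewrite coact_mon tlift_sum (bigD1 set0) ?sub0set //= big1 => [|F /andP[_ F0]].
  rewrite ninv0l scale1r tlift_tprod; last first.
    by apply: bilin_scale; [exact: const_coef_linear | lin].
  by rewrite const_coef_mon eqxx scale1r mon_isoE setD0 cards0 addbF addr0.
rewrite tliftZ tlift_tprod; last first.
  by apply: bilin_scale; [exact: const_coef_linear | lin].
by rewrite const_coef_mon (negPf F0) scale0r scaler0.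
Qed.

Definition colinear (f : H -> A) : Prop :=
  forall h, ρ (f h) = tlift (fun h1 h2 => f h1 ⊗ h2) (Δ h).

(** Since (π ⊗ j)ρ is the identity of A, a map that is colinear up to a right
    factor u is determined by its composite with π. *)
Lemma twisted_colinearE (f : H -> A) u :
  (forall h, ρ (f h) = tlift (fun h1 h2 => f h1 ⊗ (h2 * u)) (Δ h)) ->
  forall h, f h = tlift (fun h1 h2 => (π (f h1) : k) *: j (h2 * u)) (Δ h).
Proof.
move=> fcol h; rewrite -{1}(const_coef_coact (f h)) fcol linear_tlift; last exact: tlift_linear.
apply: eq_tlift => h1 h2; rewrite tlift_tprod //.
by apply: bilin_scale; [exact: const_coef_linear | lin].
Qed.

Lemma twisted_colinear_mon (f : H -> A) u : linear f ->
  (forall h, ρ (f h) = tlift (fun h1 h2 => f h1 ⊗ (h2 * u)) (Δ h)) ->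
  forall a Q, f (mon g x (a, Q)) = \sum_(F : {set 'I_n} | F \subset Q)
    ((-1) ^+ ninv F (Q :\: F) * π (f (mon g x (a, F)))) *:
      j (mon g x (a (+) odd #|F|, Q :\: F) * u).
Proof.
move=> flin fcol a Q; rewrite (twisted_colinearE fcol) comul_mon // tlift_sum.
apply: eq_bigr => F _; rewrite tliftZ tlift_tprod ?scalerA //.
apply: bilin_scale; last by lin.
by move=> ? ? ?; rewrite flin const_coef_linear.
Qed.

Lemma colinear_mon b : colinear b ->
  forall a Q, b (mon g x (a, Q)) = \sum_(F : {set 'I_n} | F \subset Q)
    ((-1) ^+ ninv F (Q :\: F) * π (b (mon g x (a, F)))) *:
      mon G X (a (+) odd #|F|, Q :\: F).
Proof.
move=> bcol a Q; have blin : linear b by lin.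
rewrite (twisted_colinear_mon (u := 1) blin) => [|h].
  by apply: eq_bigr => F _; rewrite mulr1 mon_isoE.
by rewrite bcol; apply: eq_tlift => h1 h2; rewrite mulr1.
Qed.

Section ColinearCoefficients.
Variables (b : 'Hom(H, A)) (θ : bool * {set 'I_n} -> k).
Hypothesis bE : forall a Q, b (mon g x (a, Q)) = \sum_(F : {set 'I_n} | F \subset Q)
    ((-1) ^+ ninv F (Q :\: F) * θ (a, F)) *: mon G X (a (+) odd #|F|, Q :\: F).

Lemma const_coef_colinear a Q : π (b (mon g x (a, Q))) = θ (a, Q).
Proof.
rewrite bE const_coef_sum (bigD1 Q) //= big1 => [|F /andP[FQ nFQ]].
  by rewrite setDv const_coef_mon eqxx ninv0r mul1r addr0 mulr1.
by rewrite const_coef_mon subset_minus_eq0 // (negPf nFQ) mulr0.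
Qed.

(** Coassociativity: b(h) = θ(h_1) j(h_2) is colinear because j is. *)
Lemma colinear_of_coef : colinear b.
Proof.
pose θh : 'Hom(H, k^o) := basis_ext (mon g x) (fun aP => θ aP : k^o).
have θhE aP : θh (mon g x aP) = θ aP by apply/basis_extE/(En_mon_basis H_En).
have bT h : b h = tlift (fun h1 h2 => (θh h1 : k) *: j h2) (Δ h).
  move: h; apply: (eq_linear_basis (En_mon_basis H_En)); first by lin.
    by move=> a u v; rewrite linearP tlift_linear.
  case=> a P; rewrite bE comul_mon // tlift_sum; apply: eq_bigr => F _.
  rewrite tliftZ tlift_tprod ?θhE ?mon_isoE ?scalerA //.
  by apply: bilin_scale; lin.
move=> h; rewrite {1}bT linear_tlift; last by lin.
transitivity (tlift (fun a t => tlift (fun p q => (θh a : k) *: (j p ⊗ q)) (Δ t)) (Δ h)).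
  by apply: eq_tlift => a t; rewrite linearZ /= coact_mon_iso tlift_scale.
rewrite (coassoc hH (F := fun a p q => (θh a : k) *: (j p ⊗ q))); first last.
- by move=> a c ? ? ?; rewrite !(linearP, tensE, scalerDr) !scalerA mulrC.
- by move=> a c ? ? ?; rewrite !(linearP, tensE, scalerDr) !scalerA mulrC.
- by move=> a c ? ? ?; rewrite !(linearP, scalerDl, scalerA).
apply: eq_tlift => t c; rewrite bT.
have Llin : linear (fun u : A => u ⊗ c) by lin.
by rewrite (linear_tlift _ _ Llin); apply: eq_tlift => p q; rewrite tprodZl.
Qed.

End ColinearCoefficients.

End Clifford.

(** * The morphism condition on generators *)

Section Defects.
Variables (k : fieldType) (n : nat) (H : falgType k) (hH : hopf H).
Variables (g : H) (x : 'I_n -> H).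
Hypothesis H_En : is_En hH g x.
Variables (alpha : k) (beta gamma : 'I_n -> k) (lambda : 'I_n -> 'I_n -> k).
Variables (A : falgType k) (G : A) (X : 'I_n -> A).
Hypothesis A_Cl : is_Cl alpha beta gamma lambda G X.
Variable cA : comodule_algebra hH A.
Hypothesis cA_canonical : canonical_coaction g x cA G X.

Local Notation Δ := (comul hH).
Local Notation ρ := (coact cA).
Local Notation S := (antipode hH).
Local Notation π := (const_coef G X).
Implicit Types (P Q F T : {set 'I_n}) (i z : 'I_n).

Section Comul.
Variables (V : vectType k) (f : H -> H -> V).
Hypothesis f_bilin : bilin f.

Let f1 p q : bilin (fun u v => f (p * u) (q * v)).
Proof.
case: f_bilin => fr fl; split=> [u|v] a s t.
  by rewrite mulrDr -scalerAr fr.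
by rewrite mulrDr -scalerAr fl.
Qed.

Let f2 p q : bilin (fun u v => f (u * p) (v * q)).
Proof.
case: f_bilin => fr fl; split=> [u|v] a s t.
  by rewrite mulrDl -scalerAl fr.
by rewrite mulrDl -scalerAl fl.
Qed.

Let bilin_l h : bilin (fun a b => tlift (fun c d => f (a * c) (b * d)) (Δ h)).
Proof.
by split=> [u|v]; apply: tlift_linear_param => p q; [apply: (f2 _ _).1 | apply: (f2 _ _).2].
Qed.

Lemma tlift_comul_gl h : tlift f (Δ (g * h)) = tlift (fun p q => f (g * p) (g * q)) (Δ h).
Proof. by rewrite comulM (En_comul_g H_En) tlift_tmul // tlift_tprod. Qed.

Lemma tlift_comul_gr h : tlift f (Δ (h * g)) = tlift (fun p q => f (p * g) (q * g)) (Δ h).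
Proof.
by rewrite comulM (En_comul_g H_En) tlift_tmul //; apply: eq_tlift => p q; rewrite tlift_tprod.
Qed.

Lemma tlift_comul_xl i h :
  tlift f (Δ (x i * h)) = tlift (fun p q => f (x i * p) (g * q) + f p (x i * q)) (Δ h).
Proof.
rewrite comulM (En_comul_x H_En) tlift_tmul // tliftD !tlift_tprod // tlift_add.
by congr (_ + _); apply: eq_tlift => p q; rewrite mul1r.
Qed.

Lemma tlift_comul_xr i h :
  tlift f (Δ (h * x i)) = tlift (fun p q => f (p * x i) (q * g) + f p (q * x i)) (Δ h).
Proof.
rewrite comulM (En_comul_x H_En) tlift_tmul //; apply: eq_tlift => p q.
by rewrite tliftD !tlift_tprod // mulr1.
Qed.

End Comul.

Lemma mul_xg i : x i * g = - (g * x i). Proof. by rewrite (En_gx H_En) opprK. Qed.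

Lemma mul_ggl (h : H) : g * (g * h) = h. Proof. by rewrite mulrA (mul_gg H_En) mul1r. Qed.

Lemma mul_ggr (h : H) : h * g * g = h. Proof. by rewrite -mulrA (mul_gg H_En) mulr1. Qed.

Lemma mul_xx i i' : x i * x i' = - (x i' * x i).
Proof.
have [ii'|ii'|/val_inj ->] := ltngtP i i'; first exact: En_xxC H_En _ _ ii'.
  by rewrite (En_xxC H_En ii') opprK.
by rewrite -expr2 (En_xx H_En) oppr0.
Qed.

Variable b : 'Hom(H, A).

(** Difference of the two sides of the morphism condition at a = G, in terms of
    b = BA(1 ⊗ -); likewise for X_i below. *)
Definition Gdefect (h : H) : A := G * b (g * h * g) - b h * G.

Definition Xdefect (i : 'I_n) (h : H) : A :=
  X i * b (g * h * g) + b (g * x i * h * g) + b (h * x i) - b h * X i.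

Lemma linear_sub (U V : vectType k) (p q : U -> V) :
  linear p -> linear q -> linear (fun u => p u - q u).
Proof. by move=> pl ql a u v; rewrite pl ql scalerBr opprD addrACA. Qed.

Lemma linear_add (U V : vectType k) (p q : U -> V) :
  linear p -> linear q -> linear (fun u => p u + q u).
Proof. by move=> pl ql a u v; rewrite pl ql scalerDr addrACA. Qed.

Lemma Gdefect_linear : linear Gdefect.
Proof. by apply: linear_sub; lin. Qed.

Lemma Xdefect_linear i : linear (Xdefect i).
Proof. by apply: linear_sub; first apply: linear_add; first apply: linear_add; lin. Qed.

Section Colinear.
Hypothesis b_colinear : colinear cA b.

Let tmul_linearl (t : tens A H) : linear (fun s => tmul s t).
Proof. exact: tlift_linear. Qed.

Let tmul_linearr (t : tens A H) : linear (tmul t).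
Proof. by move=> a u v; rewrite tmulDr tmulZr. Qed.

Let coact_conj h :
  ρ (b (g * h * g)) = tlift (fun p q => b (g * p * g) ⊗ (g * q * g)) (Δ h).
Proof.
rewrite b_colinear tlift_comul_gr; last by lin.
by rewrite tlift_comul_gl; last by lin.
Qed.

(** The factor g on the right makes up for the conjugation of h by g; in
    [Xdefect_colinear] the terms with x_i in the second component cancel. *)
Lemma Gdefect_colinear h :
  ρ (Gdefect h) = tlift (fun p q => Gdefect p ⊗ (q * g)) (Δ h).
Proof.
have [rhoG _] := cA_canonical.
rewrite /Gdefect linearB /= !coactM rhoG coact_conj b_colinear.
rewrite (linear_tlift _ _ (tmul_linearr _)) (linear_tlift _ _ (tmul_linearl _)).
rewrite -scaleN1r -tlift_scale -tlift_add; apply: eq_tlift => p q.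
by rewrite !tmulE -!mulrA mul_ggl tprodDl tprodNl scaleN1r.
Qed.

Lemma Xdefect_colinear i h :
  ρ (Xdefect i h) = tlift (fun p q => Xdefect i p ⊗ (q * g)) (Δ h).
Proof.
have [_ rhoX] := cA_canonical.
rewrite /Xdefect linearB !linearD /= !coactM rhoX coact_conj !b_colinear.
rewrite (linear_tlift _ _ (tmul_linearr _)) (linear_tlift _ _ (tmul_linearl _)).
rewrite tlift_comul_xr; last by lin.
rewrite tlift_comul_gr; last by lin.
rewrite -mulrA tlift_comul_gl; last by lin.
rewrite tlift_comul_xl; last by lin.
rewrite -scaleN1r -tlift_scale -!tlift_add; apply: eq_tlift => p q.
rewrite tmulDl tmulDr !tmulE !mulr1 !mul1r scaleN1r.
have -> : g * (g * q * g) = q * g by rewrite -!mulrA mul_ggl.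
have -> : x i * (g * q * g) = - (g * (x i * q) * g) by rewrite !mulrA mul_xg !mulNr.
rewrite mul_ggl !mulrA !tprodDl !tprodNl tprodNr [X in X + _ - _]addrACA addNr addr0.
by rewrite addrA opprD [- _ - _]addrC addrA addrK.
Qed.

End Colinear.

(** ** The defects on monomials *)

Lemma conj_mon a Q : g * mon g x (a, Q) * g = (-1) ^+ #|Q| *: mon g x (a, Q).
Proof.
rewrite /mon /= mulrA; have -> : g * g ^+ a = g ^+ a * g by case: a; rewrite ?mulr1 ?mul1r.
rewrite -!mulrA anticomm_monr => [|i _]; last exact: En_gx H_En i.
by rewrite -!scalerAr mul_ggl.
Qed.

Lemma Gdefect_mon a Q :
  Gdefect (mon g x (a, Q)) =
  (-1) ^+ #|Q| *: (G * b (mon g x (a, Q))) - b (mon g x (a, Q)) * G.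
Proof. by rewrite /Gdefect conj_mon linearZ /= -scalerAr. Qed.

Lemma x_mon i a Q :
  x i * mon g x (a, Q) = ((-1) ^+ a * (-1) ^+ #|Q|) *: (mon g x (a, Q) * x i).
Proof.
rewrite /mon /= mulrA; have -> : x i * g ^+ a = (-1) ^+ a *: (g ^+ a * x i).
  by case: a; rewrite ?mulr1 ?mul1r ?scale1r //= !expr1 mul_xg scaleN1r.
rewrite -scalerAl -!mulrA (anticomm_mon (u := x i)) => [|i' _]; last exact: mul_xx.
by rewrite -scalerAr scalerA.
Qed.

Lemma conj_x_mon i a Q :
  g * x i * mon g x (a, Q) * g = (-1) ^+ (~~ a) *: (mon g x (a, Q) * x i).
Proof.
move: (conj_mon a Q) (x_mon i a Q); move: (mon g x (a, Q)) => m conj_m x_m.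
rewrite -(mulrA g) x_m -scalerAr -scalerAl -!mulrA mul_xg !mulrN !mulrA conj_m.
rewrite -scalerAl -scaleN1r !scalerA; congr (_ *: _).
rewrite mulrAC -[_ * _ * (-1) ^+ #|Q|]mulrA -exprMn mulrNN mulr1 expr1n mulr1.
by case: (a); rewrite ?mulrNN ?mulr1 ?mul1r.
Qed.

Lemma Xdefect_mon_false i Q :
  Xdefect i (mon g x (false, Q)) =
  (-1) ^+ #|Q| *: (X i * b (mon g x (false, Q))) - b (mon g x (false, Q)) * X i.
Proof.
rewrite /Xdefect conj_mon conj_x_mon !linearZ /= -scalerAr; congr (_ - _).
by rewrite scaleN1r addrNK.
Qed.

Lemma Xdefect_mon_true i Q :
  Xdefect i (mon g x (true, Q)) =
  (-1) ^+ #|Q| *: (X i * b (mon g x (true, Q))) +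
    2%:R *: b (mon g x (true, Q) * x i) - b (mon g x (true, Q)) * X i.
Proof.
rewrite /Xdefect conj_mon conj_x_mon !linearZ /= -scalerAr; congr (_ - _).
by rewrite scale1r -addrA scaler_nat.
Qed.

(** ** Their π-values *)

Lemma Cl_XX_contract z Q : (forall q, q \in Q -> (q < z)%N) ->
  X z * En_mon X Q = (-1) ^+ #|Q| *: En_mon X (z |: Q) +
    \sum_(i in Q) ((-1) ^+ #|[set p in Q | (p < i)%N]| * lambda i z) *: En_mon X (Q :\ i).
Proof.
move=> Qz; rewrite En_monU1 //; apply: contraction_mon => i iQ.
by rewrite addrC (Cl_XXC A_Cl) // Qz.
Qed.

Lemma Cl_GX_contract Q :
  G * En_mon X Q = (-1) ^+ #|Q| *: (En_mon X Q * G) +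
    \sum_(i in Q) ((-1) ^+ #|[set p in Q | (p < i)%N]| * gamma i) *: En_mon X (Q :\ i).
Proof. by apply: contraction_mon => i _; apply: (Cl_GX A_Cl). Qed.

Lemma GG : G * G = alpha%:A. Proof. by rewrite -expr2 (Cl_GG A_Cl). Qed.

Lemma const_coef_false Q : π (En_mon X Q) = (Q == set0)%:R.
Proof. by rewrite -(const_coef_mon A_Cl false) /mon mul1r. Qed.

Lemma const_coef_true Q : π (G * En_mon X Q) = (Q == set0)%:R.
Proof. by rewrite -(const_coef_mon A_Cl true). Qed.

Lemma sign_coset1 (P : {set 'I_n}) (i : 'I_n) (c : k) :
  (-1) ^+ #|[set p in P | (p < i)%N]| * c * (P :\ i == set0)%:R =
  if P :\ i == set0 then c else 0.
Proof.
case: eqP => [Pi|_]; last by rewrite mulr0.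
rewrite mulr1; suff -> : [set p in P | (p < i)%N] = set0 by rewrite cards0 mul1r.
apply/setP => p; rewrite !inE; apply/negP => /andP[pP pi].
by have /setP/(_ p) := Pi; rewrite !inE pP andbT; case: eqP pi => // ->; rewrite ltnn.
Qed.

Lemma coset1_odd (P : {set 'I_n}) (i : 'I_n) : i \in P -> P :\ i == set0 -> odd #|P|.
Proof. by move=> iP /eqP Pi; rewrite (cardsD1 i) iP Pi cards0. Qed.

Lemma const_coef_contract (c : 'I_n -> k) (P : {set 'I_n}) :
  π (\sum_(i in P) ((-1) ^+ #|[set p in P | (p < i)%N]| * c i) *: En_mon X (P :\ i)) =
  \sum_(i in P) if P :\ i == set0 then c i else 0.
Proof.
rewrite const_coef_sum; apply: eq_bigr => i _.
by rewrite const_coef_false sign_coset1.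
Qed.

Lemma const_coef_contractG (c : 'I_n -> k) (P : {set 'I_n}) :
  π (G * \sum_(i in P) ((-1) ^+ #|[set p in P | (p < i)%N]| * c i) *: En_mon X (P :\ i)) =
  \sum_(i in P) if P :\ i == set0 then c i else 0.
Proof.
rewrite mulr_sumr; under eq_bigr do rewrite -scalerAr.
rewrite const_coef_sum; apply: eq_bigr => i _.
by rewrite const_coef_true sign_coset1.
Qed.

Lemma sum_coset1_even (c : 'I_n -> k) (P : {set 'I_n}) : ~~ odd #|P| ->
  \sum_(i in P) (if P :\ i == set0 then c i else 0) = 0.
Proof.
move=> evenP; apply: big1 => i iP; case: ifP => // Pi.
by rewrite (coset1_odd iP Pi) in evenP.
Qed.

Section ConstCoef.
Hypothesis b_colinear : colinear cA b.
Local Notation θ a F := (π (b (mon g x (a, F)))).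

(** Only subsets F of Q that miss exactly one element contribute, and then the
    sign of the coefficient counts the elements of Q above the missing one. *)
Lemma coef_coset1 a (c : 'I_n -> k) Q :
  \sum_(F : {set 'I_n} | F \subset Q) ((-1) ^+ ninv F (Q :\: F) * θ a F) *
     \sum_(i in Q :\: F) (if (Q :\: F) :\ i == set0 then c i else 0) =
  \sum_(i in Q) (-1) ^+ #|[set q in Q | (i < q)%N]| * c i * θ a (Q :\ i).
Proof.
under eq_bigr => F _.
  rewrite mulr_sumr; under eq_bigr => i _ do rewrite (fun_if ( *%R _)) mulr0.
over.
rewrite sum_coset1; apply: eq_bigr => i iQ.
have -> : Q :\: (Q :\ i) = [set i].
  by rewrite setDDr setDv set0U; apply/setIidPr; rewrite sub1set.
rewrite ninv_set1r mulrAC; congr ((_ ^+ _) * _ * _).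
congr #|pred_of_set _|; apply/setP => q; rewrite !inE.
by case: eqVneq => //= ->; rewrite ltnn andbF.
Qed.

(** The monomials of b(x_T) with nonzero contribution are G, from F = T, and the
    X_i, from F = T minus i. *)
Lemma const_coef_Gdefect T : odd #|T| ->
  π (Gdefect (mon g x (false, T))) =
  - (2%:R * alpha * θ false T +
     \sum_(i in T) (-1) ^+ #|[set q in T | (i < q)%N]| * gamma i * θ false (T :\ i)).
Proof.
move=> oddT; rewrite Gdefect_mon -signr_odd oddT expr1 scaleN1r -opprD const_coefN.
congr (- _); rewrite {1 2}(colinear_mon H_En A_Cl cA_canonical b_colinear).
rewrite mulr_sumr mulr_suml -big_split.
under eq_bigr => F _ do rewrite /= -scalerAr -scalerAl -scalerDr.
rewrite const_coef_sum -coef_coset1.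
have key F : F \subset T ->
    π (G * mon G X (false (+) odd #|F|, T :\: F) + mon G X (false (+) odd #|F|, T :\: F) * G) =
    (F == T)%:R * (2%:R * alpha) +
    \sum_(i in T :\: F) (if (T :\: F) :\ i == set0 then gamma i else 0).
  move=> FT; have oddTF : odd #|T :\: F| = ~~ odd #|F|.
    by rewrite cardsD (setIidPr FT) oddB ?subset_leq_card // oddT.
  have GP := Cl_GX_contract (T :\: F); rewrite -signr_odd oddTF in GP.
  case: (boolP (odd #|F|)) oddTF GP => oddF /= oddTF GP; rewrite /mon /= ?mul1r.
    have {}GP : En_mon X (T :\: F) * G = G * En_mon X (T :\: F) -
        \sum_(i in T :\: F) ((-1) ^+ #|[set p in T :\: F | (p < i)%N]| * gamma i)
          *: En_mon X ((T :\: F) :\ i) by rewrite GP scale1r addrK.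
    rewrite -[G * _ * G]mulrA GP mulrBr [G * (G * _)]mulrA GG -scalerAl mul1r.
    rewrite const_coefD const_coefD const_coefN const_coef_contractG const_coefZ.
    rewrite const_coef_false subset_minus_eq0 // sum_coset1_even ?oddTF // oppr0 !addr0; ring.
  rewrite GP scaleN1r addrAC addNr add0r const_coef_contract.
  have /negPf -> : F != T by apply: contraNneq oddF => ->.
  by rewrite mul0r add0r.
transitivity (\sum_(F : {set 'I_n} | F \subset T)
    ((-1) ^+ ninv F (T :\: F) * θ false F * ((F == T)%:R * (2%:R * alpha)) +
     (-1) ^+ ninv F (T :\: F) * θ false F * \sum_(i in T :\: F) (if (T :\: F) :\ i == set0 then gamma i else 0))).
  by apply: eq_bigr => F FT; rewrite key // mulrDr.
rewrite big_split /=; congr (_ + _); rewrite (bigD1 T) //= big1 => [|F /andP[_ /negPf->]].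
  by rewrite setDv ninv0r eqxx addr0 !mul1r mulrC.
by rewrite mul0r mulr0.
Qed.

(** The value vanishes precisely when the coefficients θ obey the recursion
    of [wedge_coef]. *)
Lemma const_coef_Xdefect Q z : (forall q, q \in Q -> (q < z)%N) ->
  π (Xdefect z (mon g x (true, Q))) =
  2%:R * θ true (z |: Q) +
  ((~~ odd #|Q|)%:R * gamma z * θ true Q +
   \sum_(i in Q) (-1) ^+ #|[set q in Q | (i < q)%N]| * lambda i z * θ true (Q :\ i)).
Proof.
move=> Qz; rewrite Xdefect_mon_true addrAC addrC const_coefD const_coefZ.
have -> : mon g x (true, Q) * x z = mon g x (true, z |: Q).
  by rewrite /mon /= En_monU1 // mulrA.
congr (_ + _); rewrite {1 2}(colinear_mon H_En A_Cl cA_canonical b_colinear).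
rewrite mulr_sumr mulr_suml scaler_sumr -sumrB.
under eq_bigr => F _ do rewrite /= -scalerAr -scalerAl scalerA mulrC -scalerA -scalerBr.
rewrite const_coef_sum -coef_coset1.
have key F : F \subset Q ->
    π ((-1) ^+ #|Q| *: (X z * mon G X (true (+) odd #|F|, Q :\: F)) -
       mon G X (true (+) odd #|F|, Q :\: F) * X z) =
    (F == Q)%:R * ((~~ odd #|Q|)%:R * gamma z) +
    \sum_(i in Q :\: F) (if (Q :\: F) :\ i == set0 then lambda i z else 0).
  move=> FQ; have oddQF : odd #|Q :\: F| = odd #|Q| (+) odd #|F|.
    by rewrite cardsD (setIidPr FQ) oddB ?subset_leq_card.
  have QFz p : p \in Q :\: F -> (p < z)%N by move=> /setDP[/Qz].
  have zQF : z |: (Q :\: F) != set0 by apply/set0Pn; exists z; rewrite setU11.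
  have XP := Cl_XX_contract QFz.
  have -> : mon G X (true (+) odd #|F|, Q :\: F) * X z = mon G X (true (+) odd #|F|, z |: (Q :\: F)).
    by rewrite /mon /= En_monU1 // mulrA.
  rewrite const_coefD const_coefN (const_coef_mon A_Cl) (negPf zQF) oppr0 addr0 const_coefZ -signr_odd.
  case: (boolP (odd #|F|)) oddQF => oddF /= oddQF; rewrite /mon /= ?mul1r.
    rewrite XP const_coefD const_coefZ const_coef_false (negPf zQF) mulr0 add0r const_coef_contract.
    case: (boolP (odd #|Q|)) oddQF => oddQ oddQF /=.
      by rewrite sum_coset1_even ?oddQF // mul0r !mulr0 addr0.
    have /negPf -> : F != Q by apply: contraNneq oddQ => <-.
    by rewrite mul0r add0r expr0 mul1r.
  have -> : X z * (G * En_mon X (Q :\: F)) = gamma z *: En_mon X (Q :\: F) -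
      ((-1) ^+ #|Q :\: F| *: (G * En_mon X (z |: Q :\: F)) +
       G * \sum_(i in Q :\: F) ((-1) ^+ #|[set p in Q :\: F | (p < i)%N]| * lambda i z)
          *: En_mon X ((Q :\: F) :\ i)).
    rewrite scalerAr -mulrDr -XP -mulr_algl -(Cl_GX A_Cl) mulrDl.
    by rewrite addrAC !mulrA subrr add0r.
  rewrite const_coefD const_coefN const_coefD !const_coefZ const_coef_contractG.
  rewrite const_coef_false const_coef_true (negPf zQF) mulr0 add0r subset_minus_eq0 //.
  case: (boolP (odd #|Q|)) oddQF => oddQ oddQF /=.
    have /negPf -> : F != Q by apply: contraTneq oddQ => <-.
    by rewrite mulr0 mul0r !add0r expr1 mulN1r opprK.
  by rewrite sum_coset1_even ?oddQF // oppr0 !addr0 expr0; ring.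
transitivity (\sum_(F : {set 'I_n} | F \subset Q)
    ((-1) ^+ ninv F (Q :\: F) * θ true F * ((F == Q)%:R * ((~~ odd #|Q|)%:R * gamma z)) +
     (-1) ^+ ninv F (Q :\: F) * θ true F * \sum_(i in Q :\: F) (if (Q :\: F) :\ i == set0 then lambda i z else 0))).
  by apply: eq_bigr => F FT; rewrite key // mulrDr.
rewrite big_split /=; congr (_ + _); rewrite (bigD1 Q) //= big1 => [|F /andP[_ /negPf->]].
  by rewrite setDv ninv0r eqxx addr0 !mul1r mulrC.
by rewrite mul0r mulr0.
Qed.

End ConstCoef.

End Defects.

(** * Casimir maps *)

(** Wedging with u and with v anticommute: the two double products differ by
    w(uv + vu) - (uv + vu)w. *)
Lemma wedge_anticomm (k : fieldType) (T : falgType k) (s c : k) (w u v : T) :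
  s * s = 1 -> u * v + v * u = c%:A ->
  (w * u - s *: (u * w)) * v + s *: (v * (w * u - s *: (u * w))) =
  - ((w * v - s *: (v * w)) * u + s *: (u * (w * v - s *: (v * w)))).
Proof.
move=> ss uv; apply/eqP; rewrite -addr_eq0.
have expand (p q : T) : (w * p - s *: (p * w)) * q + s *: (q * (w * p - s *: (p * w))) =
    w * (p * q) - q * p * w + s *: (q * w * p - p * w * q).
  rewrite mulrBl mulrBr -scalerAl -scalerAr !scalerBr scalerA ss scale1r !mulrA.
  by rewrite addrACA [RHS]addrACA; congr (_ + _); rewrite addrC.
rewrite !expand addrACA -scalerDr [X in _ + s *: X]addrA addrNK subrr scaler0 addr0.
rewrite addrACA -mulrDr -opprD -mulrDl [v * u + _]addrC uv.
by rewrite -scalerAr -scalerAl mulr1 mul1r subrr.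
Qed.

Lemma scaler_swap (R : comPzRingType) (V : lmodType R) (r s : R) (v : V) :
  r *: (s *: v) = s *: (r *: v).
Proof. by rewrite !scalerA mulrC. Qed.

Section CasimirMaps.
Variables (k : fieldType) (n : nat).
Hypothesis two_neq0 : 2%:R != 0 :> k.
Variables (H : falgType k) (hH : hopf H) (g : H) (x : 'I_n -> H).
Hypothesis H_En : is_En hH g x.
Variables (alpha : k) (beta gamma : 'I_n -> k) (lambda : 'I_n -> 'I_n -> k).
Variables (A : falgType k) (G : A) (X : 'I_n -> A).
Hypothesis A_Cl : is_Cl alpha beta gamma lambda G X.
Variable cA : comodule_algebra hH A.
Hypothesis cA_canonical : canonical_coaction g x cA G X.

Local Notation Δ := (comul hH).
Local Notation ρ := (coact cA).
Local Notation S := (antipode hH).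
Local Notation π := (const_coef G X).
Local Notation j := (mon_iso g x G X).
Implicit Types (P Q F T : {set 'I_n}) (i z : 'I_n) (b : 'Hom(H, A)).
Implicit Types (mu : k) (eta : {set 'I_n} -> k).

(** Values of θ prescribed by the parameters of the theorem; see [has_coef]. *)
Definition coef mu eta (aF : bool * {set 'I_n}) : k :=
  if aF.1 then mu * wedge_coef gamma lambda aF.2 else eta aF.2.

Definition has_coef mu eta b : Prop :=
  forall a Q, b (mon g x (a, Q)) = \sum_(F : {set 'I_n} | F \subset Q)
    ((-1) ^+ ninv F (Q :\: F) * coef mu eta (a, F)) *: mon G X (a (+) odd #|F|, Q :\: F).

Definition eta_recursion eta : Prop :=
  alpha != 0 -> forall T, odd #|T| ->
    2%:R * alpha * eta T =
    - \sum_(i in T) (-1) ^+ #|[set q in T | (i < q)%N]| * gamma i * eta (T :\ i).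

Record casimir_map b : Prop := CasimirMap {
  casimir_map_colinear : colinear cA b;
  casimir_map1 : b 1 = 1;
  casimir_mapG : forall h, Gdefect g G b h = 0;
  casimir_mapX : forall i h, Xdefect g x X b i h = 0 }.

(** The quadratic form of A is alpha times the square of the linear form with
    value 1 on G and c i on X i. With c i = gamma i / (2 alpha) this covers both
    cases of the theorem, since then c = 0 if alpha = 0. *)
Definition rank_le1 (c : 'I_n -> k) : Prop :=
  [/\ forall i, gamma i = 2%:R * alpha * c i, forall i, beta i = alpha * c i ^+ 2
    & forall i i' : 'I_n, (i < i')%N -> lambda i i' = 2%:R * alpha * c i * c i'].

Lemma mon_00 (T : falgType k) (u : T) (y : 'I_n -> T) : mon u y (false, set0) = 1.
Proof. by rewrite /mon En_mon0 mulr1. Qed.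

Lemma scalar_inj (c d : k) : c%:A = d%:A :> A -> c = d.
Proof.
move=> /eqP; rewrite -subr_eq0 -scalerBl scaler_eq0 oner_eq0 orbF subr_eq0.
by move/eqP.
Qed.

Section Necessity.
Variable b : 'Hom(H, A).
Hypothesis b_cas : casimir_map b.
Let bcol := casimir_map_colinear b_cas.
Local Notation θ a F := (π (b (mon g x (a, F)))).

Lemma theta_false0 : θ false set0 = 1.
Proof.
by rewrite mon_00 (casimir_map1 b_cas) -(mon_00 G X) (const_coef_mon A_Cl) eqxx.
Qed.

Lemma casimir_map_x i : b (x i) = X i + θ false [set i] *: G.
Proof.
have -> : b (x i) = b (mon g x (false, [set i])) by rewrite /mon mul1r En_mon1.
rewrite {1}(colinear_mon H_En A_Cl cA_canonical bcol) -[[set i] in LHS]setU0 sum_subsetU1 ?inE //.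
have sub0 (f : {set 'I_n} -> A) : \sum_(F : {set 'I_n} | F \subset set0) f F = f set0.
  by apply: big_pred1 => F; rewrite subset0.
rewrite !sub0 !setU0 setD0 setDv ninv0l ninv0r cards0 cards1 !mul1r theta_false0 scale1r.
by rewrite /mon /= mul1r En_mon1 En_mon0 mulr1.
Qed.

Lemma casimir_map_rank_le1 :
  (forall i, gamma i + 2%:R * alpha * θ false [set i] = 0) /\
  (forall i i', X i' * X i + X i * X i' = - (θ false [set i] * gamma i')%:A).
Proof.
have oddx i : g * x i * g = - x i by rewrite (En_gx H_En) mulNr (mul_ggr H_En).
split=> [i|i i'].
  apply: scalar_inj; rewrite scale0r scalerDl.
  have := casimir_mapG b_cas (x i).
  rewrite /Gdefect oddx linearN /= casimir_map_x mulrN -opprD => /eqP; rewrite oppr_eq0 => /eqP.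
  rewrite mulrDr mulrDl -scalerAr -scalerAl (GG A_Cl) addrACA (Cl_GX A_Cl) => <-.
  by rewrite -mulrA -mulr2n -scaler_nat !scalerA -!mulrA [alpha * _]mulrC.
have := casimir_mapX b_cas i' (x i).
rewrite /Xdefect oddx linearN /= mulrN.
have -> : g * x i' * x i * g = - (x i * x i').
  rewrite -!mulrA (mul_xg H_En) !mulrN !mulrA oddx mulNr opprK.
  exact: mul_xx H_En i' i.
rewrite linearN /= addrNK casimir_map_x -opprD => /eqP.
rewrite oppr_eq0 mulrDr mulrDl addrACA -scalerAr -scalerAl -scalerDr.
by rewrite [X i' * G + _]addrC (Cl_GX A_Cl) scalerA addr_eq0 => /eqP.
Qed.

(** A Casimir map forces the quadratic form of A to have rank at most one:
    b(x_i) = X_i + c G has to anticommute with every generator. *)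
Lemma casimir_map_cases :
  [/\ alpha = 0, forall i, beta i = 0, forall i, gamma i = 0
    & forall i i' : 'I_n, (i < i')%N -> lambda i i' = 0] \/
  [/\ alpha != 0, forall i, beta i = gamma i ^+ 2 / (4%:R * alpha)
    & forall i i' : 'I_n, (i < i')%N -> lambda i i' = gamma i * gamma i' / (2%:R * alpha)].
Proof.
have [gammaE XX] := casimir_map_rank_le1.
have betaE i : 2%:R * beta i = - (θ false [set i] * gamma i).
  by apply: scalar_inj; rewrite scaleNr -XX -expr2 (Cl_XX A_Cl) -scalerDl; congr (_ *: _); ring.
have lambdaE i i' : (i < i')%N -> lambda i i' = - (θ false [set i] * gamma i').
  by move=> ii'; apply: scalar_inj; rewrite scaleNr -XX addrC (Cl_XXC A_Cl).
have [alpha0|alpha0] := eqVneq alpha 0; [left|right].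
  have gamma0 i : gamma i = 0.
    by move: (gammaE i); rewrite alpha0 mulr0 mul0r addr0.
  split=> // [i|i i' ii']; last by rewrite lambdaE // gamma0 mulr0 oppr0.
  by apply: (mulfI two_neq0); rewrite betaE gamma0 !mulr0 oppr0.
have four_neq0 : 4%:R != 0 :> k by rewrite (natrM _ 2 2) mulf_neq0.
have thetaE i : - θ false [set i] = gamma i / (2%:R * alpha).
  have /eqP := gammaE i; rewrite addr_eq0 => /eqP ->.
  by field; rewrite two_neq0 alpha0.
split=> // [i|i i' ii']; last by rewrite lambdaE // -mulNr thetaE mulrAC.
apply: (mulfI two_neq0); rewrite betaE -mulNr thetaE.
have four : 4%:R = 2%:R * 2%:R :> k by rewrite -natrM.
by field; rewrite alpha0 four_neq0 two_neq0.
Qed.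

(** The recursion for eta is the vanishing of [const_coef_Gdefect]; the vanishing
    of [const_coef_Xdefect] shows by induction that the coefficients at g x_F are
    multiples of [wedge_coef]. *)
Lemma casimir_map_has_coef : exists mu eta, has_coef mu eta b /\ eta_recursion eta.
Proof.
exists (θ true set0), (fun F => θ false F); split=> [a Q|alpha0 T oddT]; last first.
  have := const_coef_Gdefect H_En A_Cl cA_canonical bcol oddT.
  rewrite (casimir_mapG b_cas) -(scale0r 0) const_coefZ mul0r => /eqP.
  by rewrite eq_sym oppr_eq0 addr_eq0 => /eqP.
rewrite (colinear_mon H_En A_Cl cA_canonical bcol); apply: eq_bigr => F _.
congr ((_ * _) *: _); case: a => //=.
suff: forall P, P \subset F -> θ true P = θ true set0 * wedge_coef gamma lambda P.
  by apply.
elim/set_max_ind: F => [P|F z Fz IH P PF].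
  by rewrite subset0 => /eqP->; rewrite wedge_coef0 // mulr1.
have zF := notin_max Fz; case: (boolP (z \in P)) => [zP|zP]; last first.
  apply: IH; apply/subsetP => p pP; have := subsetP PF p pP; rewrite !inE => /orP[/eqP pz|//].
  by rewrite pz (negPf zP) in pP.
have subF : P :\ z \subset F by rewrite subDset.
have ltz p : p \in P :\ z -> (p < z)%N by move=> /(subsetP subF)/Fz.
have := const_coef_Xdefect H_En A_Cl cA_canonical bcol ltz.
rewrite (casimir_mapX b_cas) -(scale0r 0) const_coefZ mul0r => /esym/eqP.
rewrite addr_eq0 setD1K // => /eqP rec_theta.
apply: (mulfI two_neq0); rewrite rec_theta mulrCA -[in RHS](setD1K zP) wedge_coef_rec //.
rewrite mulrN mulrDr; congr (- (_ + _)); first by rewrite IH //; ring.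
rewrite mulr_sumr; apply: eq_bigr => i iP; rewrite IH; first by ring.
by apply: subset_trans subF; apply: subD1set.
Qed.

End Necessity.
Section Sufficiency.
Variables (c : 'I_n -> k) (mu : k) (eta : {set 'I_n} -> k) (b : 'Hom(H, A)).
Hypotheses (rank1 : rank_le1 c) (b_coef : has_coef mu eta b).
Hypotheses (eta_rec : eta_recursion eta).

Let bcol : colinear cA b := colinear_of_coef H_En cA_canonical b_coef.

Let theta_b a Q : π (b (mon g x (a, Q))) = coef mu eta (a, Q).
Proof. exact: (const_coef_colinear A_Cl b_coef). Qed.

Lemma scale2_inj (v w : A) : 2%:R *: v = 2%:R *: w -> v = w.
Proof. by move=> /(congr1 ( *:%R 2%:R^-1)); rewrite !scalerA mulVf // !scale1r. Qed.

Lemma XX_rel i i' : X i * X i' + X i' * X i = (2%:R * alpha * c i * c i')%:A.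
Proof.
case: rank1 => _ betaE lambdaE.
have [ii'|ii'|/val_inj ->] := ltngtP i i'.
- by rewrite (Cl_XXC A_Cl) // lambdaE.
- by rewrite addrC (Cl_XXC A_Cl) // lambdaE //; congr (_ *: _); ring.
by rewrite -expr2 (Cl_XX A_Cl) betaE -scalerDl; congr (_ *: _); ring.
Qed.

(** All monomials of b(x_Q) have the parity of Q. *)
Lemma supercentral_b u Q : u * G = - (G * u) -> (forall i, u * X i = - (X i * u)) ->
  u * b (mon g x (false, Q)) = (-1) ^+ #|Q| *: (b (mon g x (false, Q)) * u).
Proof.
move=> uG uX; rewrite b_coef mulr_sumr mulr_suml scaler_sumr; apply: eq_bigr => F FQ.
rewrite -scalerAr -scalerAl [RHS]scaler_swap; congr (_ *: _).
have u_odd (a : bool) : u * G ^+ a = (-1) ^+ a *: (G ^+ a * u).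
  by case: a; rewrite ?mulr1 ?mul1r ?scale1r // !expr1 scaleN1r.
rewrite /mon /= mulrA u_odd -scalerAl -!mulrA anticomm_mon => [|i _]; last exact: uX.
rewrite -scalerAr scalerA -exprD; congr (_ *: _).
rewrite cardsD (setIidPr FQ) -[LHS]signr_odd -[RHS]signr_odd; congr (_ ^+ nat_of_bool _).
by rewrite oddD oddb oddB ?subset_leq_card // [odd #|Q| (+) _]addbC addbA addbb.
Qed.

(** If alpha = 0, then G supercommutes with all generators. Otherwise, by
    induction on Q, the defect is a multiple of 1 or of G. The first is excluded
    by the recursion for eta. The second is excluded because taking supercommutators
    with G squares to zero, while the supercommutator of G with itself is
    2 alpha. *)
Lemma Gdefect_mon_false0 Q : Gdefect g G b (mon g x (false, Q)) = 0.
Proof.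
have [alpha0|alpha0] := eqVneq alpha 0.
  case: rank1 => gammaE _ _.
  rewrite (Gdefect_mon H_En) supercentral_b => [||i].
  - by rewrite scalerA -exprMn mulrNN mulr1 expr1n scale1r subrr.
  - by rewrite (GG A_Cl) alpha0 scale0r oppr0.
  - by apply/eqP; rewrite -addr_eq0 (Cl_GX A_Cl) gammaE alpha0 mulr0 mul0r scale0r.
have [m] := ubnP #|Q|; elim: m Q => // m IH Q leQ.
have := twisted_colinear_mon H_En A_Cl cA_canonical (Gdefect_linear g G b)
  (Gdefect_colinear H_En cA_canonical bcol) false Q.
rewrite (bigD1 Q) //= big1 => [|F /andP[FQ nFQ]]; last first.
  rewrite IH; first by rewrite linear0 mulr0 scale0r.
  by rewrite -ltnS; apply: leq_trans leQ; rewrite ltnS proper_card // properEneq nFQ.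
rewrite setDv ninv0r mul1r addr0.
set κ := π _; have -> : mon g x (odd #|Q|, set0) * g = mon g x (~~ odd #|Q|, set0).
  by rewrite /mon /= En_mon0 !mulr1 -[g in _ * g]expr1 (expr_involution _ true) ?(En_gg H_En) // addbT.
have mon0 (a : bool) : mon G X (a, set0) = G ^+ a by rewrite /mon En_mon0 mulr1.
rewrite (mon_isoE H_En) mon0 => defE.
suff κ0 : κ = 0 by rewrite defE κ0 scale0r.
case: (boolP (odd #|Q|)) defE => [oddQ _|evenQ defE].
  rewrite /κ (const_coef_Gdefect H_En A_Cl cA_canonical bcol oddQ) theta_b.
  rewrite eta_rec //= -(eq_bigr _ (fun i _ => congr1 _ (theta_b false _))) addNr oppr0 //.
rewrite (Gdefect_mon H_En) -signr_odd (negPf evenQ) scale1r /= expr1 in defE.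
have /= := congr1 (fun a => G * a + a * G) defE.
rewrite mulrBr mulrBl !mulrA (GG A_Cl) -!mulrA (GG A_Cl) addrA addrNK.
rewrite -scalerAl -scalerAr mul1r mulr1 subrr -scalerAr -scalerAl -scalerDl (GG A_Cl) scalerA.
move/esym/eqP; rewrite scaler_eq0 oner_eq0 orbF mulf_eq0 (negPf alpha0) orbF.
by rewrite -mulr2n -mulr_natl mulf_eq0 (negPf two_neq0) => /eqP.
Qed.

(** X_i is the sum of a supercentral element and a multiple of G. *)
Lemma Xdefect_mon_false0 i Q : Xdefect g x X b i (mon g x (false, Q)) = 0.
Proof.
have [gammaE _ _] := rank1; pose Y := X i - c i *: G.
have YG : Y * G = - (G * Y).
  apply/eqP; rewrite -addr_eq0 /Y mulrBl mulrBr -scalerAl -scalerAr (GG A_Cl).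
  rewrite addrACA [X i * G + _]addrC (Cl_GX A_Cl) gammaE -opprD -scalerDl scalerA -scalerBl.
  by rewrite (_ : _ - _ = 0) ?scale0r //; ring.
have YX i' : Y * X i' = - (X i' * Y).
  apply/eqP; rewrite -addr_eq0 /Y mulrBl mulrBr -scalerAl -scalerAr addrACA XX_rel.
  rewrite -opprD -scalerDr (Cl_GX A_Cl) gammaE scalerA -scalerBl.
  by rewrite (_ : _ - _ = 0) ?scale0r //; ring.
have /eqP := Gdefect_mon_false0 Q; rewrite (Gdefect_mon H_En) subr_eq0 => /eqP GQ.
have YQ := supercentral_b Q YG YX.
have XE : X i = Y + c i *: G by rewrite /Y addrNK.
rewrite (Xdefect_mon_false H_En) XE mulrDl mulrDr YQ scalerDr scalerA -exprMn mulrNN mulr1 expr1n scale1r.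
by rewrite -scalerAl scaler_swap GQ scalerAr subrr.
Qed.

(** The recursions of [const_coef_Xdefect] and [wedge_coef_rec] agree. *)
Lemma Xdefect_last Q z : (forall q, q \in Q -> (q < z)%N) ->
  Xdefect g x X b z (mon g x (true, Q)) = 0.
Proof.
move=> Qz.
rewrite (twisted_colinear_mon H_En A_Cl cA_canonical (Xdefect_linear g x X b z)
  (Xdefect_colinear H_En cA_canonical bcol z)).
apply: big1 => F FQ; suff -> : π (Xdefect g x X b z (mon g x (true, F))) = 0.
  by rewrite mulr0 scale0r.
have Fz f : f \in F -> (f < z)%N by move=> /(subsetP FQ)/Qz.
rewrite (const_coef_Xdefect H_En A_Cl cA_canonical bcol Fz) !theta_b /coef /=.
under eq_bigr do rewrite theta_b /coef /= mulrCA.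
rewrite -mulr_sumr mulrCA wedge_coef_rec // mulrN mulrDr opprD.
by rewrite [_ * (mu * _)]mulrCA addrACA !addNr addr0.
Qed.

Lemma En_mon_mulx P i : exists2 e : k,
  En_mon x P * x i = e *: En_mon x (i |: P) & i \in P -> e = 0.
Proof.
elim/set_max_ind: P => [|P z Pz [e eE e0]].
  by exists 1; rewrite ?inE // En_mon0 mul1r setU0 En_mon1 scale1r.
have [iz|zi|/val_inj iz] := ltngtP i z.
- have iPz p : p \in i |: P -> (p < z)%N by case/setU1P => [->|/Pz].
  exists (- e); last by rewrite !inE -[i == z]/(i == z :> nat) ltn_eqF // => /e0->; rewrite oppr0.
  rewrite setUCA (En_monU1 _ Pz) (En_monU1 _ iPz) -mulrA (mul_xx H_En) mulrN mulrA eE.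
  by rewrite -scalerAl scaleNr.
- have iPz p : p \in z |: P -> (p < i)%N.
    by case/setU1P => [->//|/Pz pz]; apply: ltn_trans zi.
  exists 1; first by rewrite scale1r (En_monU1 _ iPz).
  by move=> /iPz; rewrite ltnn.
exists 0 => //; rewrite scale0r iz En_monU1 // -mulrA -expr2 (En_xx H_En) mulr0 //.
Qed.

Lemma wedge_mulx Q i : Xdefect g x X b i (mon g x (true, Q)) = 0 ->
  2%:R *: b (mon g x (true, Q) * x i) =
  b (mon g x (true, Q)) * X i - (-1) ^+ #|Q| *: (X i * b (mon g x (true, Q))).
Proof.
move=> /eqP; rewrite (Xdefect_mon_true H_En) subr_eq0 => /eqP <-.
by rewrite addrC addKr.
Qed.

(** Adding a largest element z to P, the case of i < z follows from the one of P
    and i, since wedging with X_i and wedging with X_z anticommute. *)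
Lemma Xdefect_mon_true0 i Q : Xdefect g x X b i (mon g x (true, Q)) = 0.
Proof.
elim/set_max_ind: Q => [|P z Pz IH]; first by apply: Xdefect_last => q; rewrite inE.
have Ez := wedge_mulx (Xdefect_last Pz); have Ei := wedge_mulx IH.
have monz : mon g x (true, z |: P) = mon g x (true, P) * x z.
  by rewrite /mon /= En_monU1 // mulrA.
have zP := notin_max Pz.
have [zi|iz] := ltnP z i.
  apply: Xdefect_last => q /setU1P[->//|/Pz qz]; exact: ltn_trans zi.
have s2 : (-1) ^+ #|P| * (-1) ^+ #|P| = 1 :> k by rewrite -exprMn mulrNN mulr1 expr1n.
(* doubled, this compares two double wedge products of b(g x_P) *)
suff key : 2%:R *: b (mon g x (true, z |: P) * x i) = 
    b (mon g x (true, z |: P)) * X i + (-1) ^+ #|P| *: (X i * b (mon g x (true, z |: P))).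
  apply/eqP; rewrite (Xdefect_mon_true H_En) key cardsU1 zP exprS mulN1r scaleNr.
  by rewrite [X in X - _]addrC addrK subrr.
have dist (v w : A) : 2%:R *: (w * v + (-1) ^+ #|P| *: (v * w)) =
    (2%:R *: w) * v + (-1) ^+ #|P| *: (v * (2%:R *: w)).
  by rewrite scalerDr scaler_swap -scalerAl -scalerAr.
apply: scale2_inj; rewrite monz dist Ez.
have anti := wedge_anticomm (b (mon g x (true, P))) s2 (XX_rel z i).
move: iz; rewrite leq_eqVlt => /orP[/eqP/val_inj iz|iz].
  rewrite iz in anti *; rewrite -mulrA -expr2 (En_xx H_En) mulr0 linear0 !scaler0.
  by apply: scale2_inj; rewrite scaler0 scaler_nat mulr2n {1}anti addNr.
rewrite anti -Ei -dist -scalerN; congr (_ *: _).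
have iPz p : p \in i |: P -> (p < z)%N by case/setU1P => [->|/Pz].
have [e eE e0] := En_mon_mulx P i.
have mE : mon g x (true, P) * x i = e *: mon g x (true, i |: P).
  by rewrite /mon /= -mulrA eE scalerAr.
have -> : mon g x (true, P) * x z * x i = - (mon g x (true, P) * x i * x z).
  by rewrite -!mulrA (mul_xx H_En) !mulrN.
rewrite linearN scalerN; congr (- _).
rewrite mE -scalerAl !linearZ /= (wedge_mulx (Xdefect_last iPz)).
rewrite -scalerAl -scalerAr [X in _ = _ + X]scaler_swap -scalerDr.
case: (boolP (i \in P)) => [/e0->|iP]; first by rewrite !scale0r.
by rewrite cardsU1 iP exprS mulN1r scaleNr opprK.
Qed.

Lemma Gdefect_mon_true0 Q : Gdefect g G b (mon g x (true, Q)) = 0.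
Proof.
suff GQ : b (mon g x (true, Q)) * G = (-1) ^+ #|Q| *: (G * b (mon g x (true, Q))).
  by rewrite (Gdefect_mon H_En) GQ subrr.
elim/set_max_ind: Q => [|P z Pz IH].
  rewrite b_coef (big_pred1 set0) => [|F]; last by rewrite subset0.
  by rewrite setDv cards0 /mon /= En_mon0 mulr1 -scalerAl -scalerAr scale1r.
have Ez := wedge_mulx (Xdefect_mon_true0 z P).
have monz : mon g x (true, z |: P) = mon g x (true, P) * x z.
  by rewrite /mon /= En_monU1 // mulrA.
have s2 : (-1) ^+ #|P| * (-1) ^+ #|P| = 1 :> k by rewrite -exprMn mulrNN mulr1 expr1n.
have XG : X z * G = (gamma z)%:A - G * X z by rewrite -(Cl_GX A_Cl) addrAC subrr add0r.
apply: scale2_inj; rewrite monz cardsU1 (notin_max Pz) exprS mulN1r scaleNr scalerN scaler_swap.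
rewrite [LHS]scalerAl [2%:R *: (G * _)]scalerAr Ez.
move: {Ez} (b (mon g x (true, P))) ((-1) ^+ #|P|) IH s2 => w s IH s2.
have wXG : w * X z * G = gamma z *: w - s *: (G * (w * X z)).
  by rewrite -mulrA XG mulrBr -scalerAr mulr1 [w * (G * _)]mulrA IH -scalerAl -mulrA.
have XwG : s *: (X z * w) * G = gamma z *: w - G * (X z * w).
  rewrite -scalerAl -mulrA IH -scalerAr scalerA s2 scale1r !mulrA XG mulrBl.
  by rewrite -scalerAl mul1r.
rewrite mulrBl wXG XwG mulrBr -scalerAr scalerBr scalerA s2 scale1r !opprB.
by rewrite addrC addrA addrNK.
Qed.

Lemma casimir_map_of_coef : b 1 = 1 -> casimir_map b.
Proof.
have basisE (V : vectType k) (f : H -> V) : linear f ->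
    (forall a Q, f (mon g x (a, Q)) = 0) -> forall h, f h = 0.
  move=> flin f0; apply: (eq_linear_basis (En_mon_basis H_En) flin) => [|[a Q]].
    by move=> a u v; rewrite scaler0 addr0.
  exact: f0.
move=> b1; split=> // [|i]; apply: basisE.
- exact: Gdefect_linear.
- by case=> Q; [apply: Gdefect_mon_true0 | apply: Gdefect_mon_false0].
- exact: Xdefect_linear.
- by case=> Q; [apply: Xdefect_mon_true0 | apply: Xdefect_mon_false0].
Qed.

End Sufficiency.
End CasimirMaps.

(** * Casimir elements *)

Section Casimir.
Variables (k : fieldType) (n : nat).
Hypothesis two_neq0 : 2%:R != 0 :> k.
Variables (H : falgType k) (hH : hopf H) (g : H) (x : 'I_n -> H).
Hypothesis H_En : is_En hH g x.
Variables (alpha : k) (beta gamma : 'I_n -> k) (lambda : 'I_n -> 'I_n -> k).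
Variables (A : falgType k) (G : A) (X : 'I_n -> A).
Hypothesis A_Cl : is_Cl alpha beta gamma lambda G X.
Variable cA : comodule_algebra hH A.
Hypothesis cA_canonical : canonical_coaction g x cA G X.

Local Notation Δ := (comul hH).
Local Notation ρ := (coact cA).
Local Notation S := (antipode hH).
Implicit Types (P Q F T : {set 'I_n}) (i z : 'I_n).
Implicit Types (mu : k) (eta : {set 'I_n} -> k) (BA : 'Hom(tens H H, A)).

Lemma slice_linear BA : linear (fun h : H => BA (1 ⊗ h)).
Proof. lin. Qed.

Definition slice BA : 'Hom(H, A) := hom_of_linear (slice_linear BA).

Lemma sliceE BA h : slice BA h = BA (1 ⊗ h).
Proof. exact: hom_of_linearE. Qed.

Section Factored.
Variable BA : 'Hom(tens H H, A).
Hypothesis BAE : forall h h' : H, BA (h ⊗ h') = BA (1 ⊗ (S h * h')).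

Let morphism_at_conj h h' a b' : BA ((h * a) ⊗ (h' * b')) = slice BA (S a * (S h * h') * b').
Proof. by rewrite BAE (antipodeM H_En) sliceE !mulrA. Qed.

Let morphism_side h h' (a : A) : BA (h ⊗ h') * a = slice BA (S h * h') * a.
Proof. by rewrite BAE sliceE. Qed.

Lemma morphism_atG_defect h h' :
  tlift (fun (a0 : A) (a12 : H) =>
      tlift (fun a1 a2 : H => a0 * BA ((h * a1) ⊗ (h' * a2)) : A) (Δ a12) : A) (ρ G) -
    BA (h ⊗ h') * G = Gdefect g G (slice BA) (S h * h').
Proof.
have [rhoG _] := cA_canonical.
rewrite rhoG tlift_tprod; last exact: morphism_bilin.
rewrite (En_comul_g H_En) tlift_tprod; last by lin.
by rewrite morphism_at_conj morphism_side (En_antipode_g H_En).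
Qed.

Lemma morphism_atX_defect i h h' :
  tlift (fun (a0 : A) (a12 : H) =>
      tlift (fun a1 a2 : H => a0 * BA ((h * a1) ⊗ (h' * a2)) : A) (Δ a12) : A) (ρ (X i)) -
    BA (h ⊗ h') * X i = Xdefect g x X (slice BA) i (S h * h').
Proof.
have [_ rhoX] := cA_canonical.
rewrite rhoX tliftD !tlift_tprod; try exact: morphism_bilin.
rewrite (En_comul_g H_En) (En_comul_x H_En) tliftD !tlift_tprod; try by lin.
rewrite !morphism_at_conj morphism_side (En_antipode_g H_En) (En_antipode_x H_En).
by rewrite (antipode1 hH) !mul1r addrA.
Qed.

(** At a = G and a = X_i the morphism condition for h ⊗ h' depends on S(h)h'
    only, and every element of H has this form. *)
Lemma factored_casimirP : casimir_component cA BA <-> casimir_map g x G X cA (slice BA).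
Proof.
split=> [[BAm BAc BAi BA1]|[bcol b1 bG bX]].
  have S1 : S 1 = 1 := antipode1 hH.
  split=> [h||h|i h].
  - rewrite sliceE BAc; apply: eq_tlift => h1 h2; by rewrite sliceE.
  - by rewrite sliceE BA1.
  - by rewrite -[h]mul1r -S1 -morphism_atG_defect BAm subrr.
  by rewrite -[h]mul1r -S1 -morphism_atX_defect BAm subrr.
split=> [a||h h' h''|].
- move: a; apply: (mon_ind (Cl_mon_basis A_Cl) (K := morphism_at cA BA)).
  + exact: morphism_at0.
  + by move=> a s t; apply: morphism_atD.
  + exact: morphism_at1.
  + exact: morphism_atM.
  + by move=> h h'; apply: subr0_eq; rewrite morphism_atG_defect bG.
  by move=> i h h'; apply: subr0_eq; rewrite morphism_atX_defect bX.
- by move=> h; rewrite -sliceE bcol; apply: eq_tlift => h1 h2; rewrite sliceE.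
- exact: ((casimir_invariantP H_En BA).2 BAE).
by rewrite -sliceE.
Qed.

End Factored.

Lemma casimir_componentP BA : casimir_component cA BA <->
  (forall h h' : H, BA (h ⊗ h') = BA (1 ⊗ (S h * h'))) /\ casimir_map g x G X cA (slice BA).
Proof.
split=> [BAc|[BAE /(factored_casimirP BAE)]//].
have BAE : forall h h' : H, BA (h ⊗ h') = BA (1 ⊗ (S h * h')).
  exact: ((casimir_invariantP H_En BA).1 (casimir_invariant BAc)).
by split=> //; apply/(factored_casimirP BAE).
Qed.

Lemma factored_mon BA :
  (forall (j l : bool) P Q, BA ((g ^+ j * En_mon x P) ⊗ (g ^+ l * En_mon x Q)) =
     BA (1 ⊗ (S (g ^+ j * En_mon x P) * (g ^+ l * En_mon x Q)))) <->
  (forall h h' : H, BA (h ⊗ h') = BA (1 ⊗ (S h * h'))).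
Proof.
split=> [BAmon h h'|BAE j l P Q]; last exact: BAE.
move: h; apply: (eq_linear_basis (En_mon_basis H_En)); try by lin.
case=> j P; move: h'; apply: (eq_linear_basis (En_mon_basis H_En)); try by lin.
by case=> l Q; apply: BAmon.
Qed.

Lemma sign_Spos1 T i : odd #|T| -> i \in T ->
  (-1) ^+ Spos [set i] T = (-1) ^+ #|[set t in T | (i < t)%N]| :> k.
Proof.
move=> oddT iT; have iTs : [set i] \subset T by rewrite sub1set.
rewrite SposE // -[LHS]signr_odd -[RHS]signr_odd; congr (_ ^+ nat_of_bool _).
have dis : [disjoint [set i] & T :\ i] by rewrite disjoints1 setD11.
have := congr1 odd (ninv_addC dis); rewrite cards1 mul1n oddD.
have -> : odd #|T :\ i| = false.
  by apply/negbTE; move: oddT; rewrite (cardsD1 i) iT.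
have -> : ninv (T :\ i) [set i] = #|[set t in T | (i < t)%N]|.
  rewrite ninv_set1r; congr #|pred_of_set _|; apply/setP => t; rewrite !inE.
  by case: eqVneq => //= ->; rewrite ltnn andbF.
by case: (odd (ninv _ _)); case: (odd _).
Qed.

Lemma eta_recursionP eta : eta_recursion alpha gamma eta <->
  (alpha != 0 -> forall T, odd #|T| ->
    eta T = \sum_(i in T) (-1) ^+ (Spos [set i] T).+1 * eta (T :\ i)
                          * (gamma i / (2%:R * alpha))).
Proof.
have sumE T : alpha != 0 -> odd #|T| ->
    2%:R * alpha * (\sum_(i in T) (-1) ^+ (Spos [set i] T).+1 * eta (T :\ i)
                          * (gamma i / (2%:R * alpha))) =
    - \sum_(i in T) (-1) ^+ #|[set q in T | (i < q)%N]| * gamma i * eta (T :\ i).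
  move=> alpha0 oddT; rewrite mulr_sumr -sumrN; apply: eq_bigr => i iT.
  by rewrite exprS sign_Spos1 //; field; rewrite two_neq0 alpha0.
split=> rec alpha0 T oddT; last by rewrite rec // sumE.
by apply: (@mulfI _ (2%:R * alpha)); rewrite ?mulf_neq0 // rec // sumE.
Qed.

Lemma casimir_formulaP mu eta BA : casimir_formula alpha gamma lambda hH g x G X mu eta BA <->
  [/\ forall h h' : H, BA (h ⊗ h') = BA (1 ⊗ (S h * h')), slice BA 1 = 1,
      has_coef g x gamma lambda G X mu eta (slice BA) & eta_recursion alpha gamma eta].
Proof.
have coef_false Q :
    \sum_(R : {set 'I_n.+1} | (R \subset Qbar Q) && (odd #|R| == odd #|Q|))
          ((-1) ^+ Spos (Qminus Q R) Q * eta (Qminus Q R)) *: Cl_mon G X R =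
    \sum_(F : {set 'I_n} | F \subset Q) ((-1) ^+ ninv F (Q :\: F) * eta F) *:
       mon G X (false (+) odd #|F|, Q :\: F).
  rewrite -[odd #|Q|]addFb (sum_Qbar_parity false); apply: eq_bigr => F FQ.
  by rewrite Qminus_Rset // SposE // Cl_mon_Rset.
have coef_true Q :
    (mu / 2%:R ^+ (#|Qbar Q|./2)) *:
        \sum_(R : {set 'I_n.+1} |
               (R \subset Qbar Q) && (odd #|R| == odd #|Qbar Q|))
          ((-1) ^+ (Spos R (Qbar Q) + (#|Qbar Q| - #|R|)./2)
           * 2%:R ^+ (#|R|./2)
           * \sum_(PP in pi2 (Qbar Q :\: R))
               matching_sgn k (Qbar Q :\: R) PP * Lambda gamma lambda PP)
          *: Cl_mon G X R =
    \sum_(F : {set 'I_n} | F \subset Q)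
       ((-1) ^+ ninv F (Q :\: F) * (mu * wedge_coef gamma lambda F)) *:
       mon G X (true (+) odd #|F|, Q :\: F).
  rewrite scaler_sumr {1}card_Qbar -[odd #|Q|.+1]/(true (+) odd #|Q|) (sum_Qbar_parity true).
  by apply: eq_bigr => F FQ; rewrite scalerA matching_coefE // Cl_mon_Rset.
split=> [[BAmon BA1 BAx BAg rec]|[BAE b1 bE rec]].
  split; [exact/factored_mon | by rewrite sliceE | | exact/eta_recursionP].
  case=> Q; rewrite sliceE /mon /=; first by rewrite BAg coef_true.
  by rewrite mul1r BAx coef_false.
split; [exact/factored_mon | by rewrite -sliceE | | | exact/eta_recursionP].
  by move=> Q; rewrite coef_false; have := bE false Q; rewrite sliceE /mon mul1r.
by move=> Q; rewrite coef_true; have := bE true Q; rewrite sliceE.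
Qed.

Lemma rank_le1_of_cases :
  [/\ alpha = 0, forall i, beta i = 0, forall i, gamma i = 0
    & forall i i' : 'I_n, (i < i')%N -> lambda i i' = 0] \/
  [/\ alpha != 0, forall i, beta i = gamma i ^+ 2 / (4%:R * alpha)
    & forall i i' : 'I_n, (i < i')%N -> lambda i i' = gamma i * gamma i' / (2%:R * alpha)] ->
  rank_le1 alpha beta gamma lambda (fun i => gamma i / (2%:R * alpha)).
Proof.
have four_neq0 : 4%:R != 0 :> k by rewrite (natrM _ 2 2) mulf_neq0.
case=> [[-> beta0 gamma0 lambda0]|[alpha0 betaE lambdaE]]; split=> [i|i|i i' ii'].
- by rewrite gamma0 !(mul0r, mulr0).
- by rewrite beta0 mul0r.
- by rewrite lambda0 // gamma0 !(mul0r, mulr0).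
- by field; rewrite two_neq0 alpha0.
- by rewrite betaE; field; rewrite alpha0 four_neq0 two_neq0.
by rewrite lambdaE //; field; rewrite two_neq0 alpha0.
Qed.

(** Some Casimir map always exists when the rank is at most one: take mu = 0
    and let the free parameters eta_T, |T| even and positive, vanish. *)
Lemma exists_casimir_map c : rank_le1 alpha beta gamma lambda c ->
  exists b : 'Hom(H, A), casimir_map g x G X cA b.
Proof.
move=> rank1; pose eta T : k := if odd #|T| then
    (2%:R * alpha)^-1 * - \sum_(i in T) (-1) ^+ #|[set q in T | (i < q)%N]| * gamma i * (T :\ i == set0)%:R
  else (T == set0)%:R.
pose b : 'Hom(H, A) := basis_ext (mon g x) (fun aQ => \sum_(F : {set 'I_n} | F \subset aQ.2)
    ((-1) ^+ ninv F (aQ.2 :\: F) * coef gamma lambda 0 eta (aQ.1, F)) *: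
       mon G X (aQ.1 (+) odd #|F|, aQ.2 :\: F)).
have bE : has_coef g x gamma lambda G X 0 eta b.
  by move=> a Q; rewrite /b (basis_extE (En_mon_basis H_En)).
exists b; apply: (casimir_map_of_coef two_neq0 H_En A_Cl cA_canonical rank1 bE).
  move=> alpha0 T oddT; rewrite {1}/eta oddT mulVKf ?mulf_neq0 //.
  congr (- _); apply: eq_bigr => i iT; congr (_ * _).
  by rewrite /eta; move: oddT; rewrite (cardsD1 i) iT /= => /negPf->.
rewrite -(mon_00 g x) bE (big_pred1 set0) => [|F]; last by rewrite subset0.
by rewrite ninv0l mul1r setDv cards0 /coef /= /eta cards0 eqxx scale1r mon_00.
Qed.

Lemma casimir_component_of_map (b : 'Hom(H, A)) : casimir_map g x G X cA b ->
  exists BA, casimir_component cA BA.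
Proof.
move=> bcas; pose f (h h' : H) := b (S h * h').
have fbil : bilin f by rewrite /f; lin.
pose BA : 'Hom(tens H H, A) := hom_of_linear (tlift_linear f).
have BAE h h' : BA (h ⊗ h') = f h h' by rewrite hom_of_linearE tlift_tprod.
have sliceb : slice BA = b.
  by apply/lfunP => h; rewrite sliceE BAE /f (antipode1 hH) mul1r.
exists BA; apply/casimir_componentP; rewrite sliceb; split=> // h h'.
by rewrite !BAE /f (antipode1 hH) mul1r.
Qed.

End Casimir.

Theorem theorem5p7 (k : fieldType) (k_char : 2%N \notin [pchar k])
    (n : nat) (n_gt0 : (0 < n)%N)
    (H : falgType k) (hH : hopf H) (g : H) (x : 'I_n -> H)
    (H_En : is_En hH g x)
    (alpha : k) (beta gamma : 'I_n -> k) (lambda : 'I_n -> 'I_n -> k)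
    (A : falgType k) (G : A) (X : 'I_n -> A)
    (A_Cl : is_Cl alpha beta gamma lambda G X)
    (cA : comodule_algebra hH A)
    (cA_canonical : canonical_coaction g x cA G X) :
  let case1 :=
    [/\ alpha = 0, forall i, beta i = 0, forall i, gamma i = 0
      & forall i j : 'I_n, (i < j)%N -> lambda i j = 0] in
  let case2 :=
    [/\ alpha != 0, forall i, beta i = gamma i ^+ 2 / (4%:R * alpha)
      & forall i j : 'I_n,
          (i < j)%N -> lambda i j = gamma i * gamma j / (2%:R * alpha)] in
  (rt_separable cA <-> case1 \/ case2) /\
  (case1 \/ case2 ->
   forall B : 'Hom(tens H H, tens A H),
     rt_casimir cA B <->
     exists BA : 'Hom(tens H H, A), has_component B BA /\
       exists (mu : k) (eta : {set 'I_n} -> k),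
         casimir_formula alpha gamma lambda hH g x G X mu eta BA).
Proof.
move=> case1 case2; have two_neq0 : 2%:R != 0 :> k.
  by move: k_char; rewrite inE.
have componentP := casimir_componentP H_En A_Cl cA_canonical.
split.
  split=> [[B [BA _ /componentP[_ bcas]]]|/(rank_le1_of_cases two_neq0) rank1].
    exact: (casimir_map_cases two_neq0 H_En A_Cl cA_canonical bcas).
  have [b bcas] := exists_casimir_map two_neq0 H_En A_Cl cA_canonical rank1.
  have [BA BAcas] := casimir_component_of_map H_En A_Cl cA_canonical bcas.
  have Blin : linear (fun t : tens H H => BA t ⊗ (1 : H)) by lin.
  by exists (hom_of_linear Blin), BA => // h h'; rewrite hom_of_linearE.
move=> /(rank_le1_of_cases two_neq0) rank1 B; split=> [[BA BBA /componentP[BAE bcas]]|].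
  have [mu [eta [bE rec]]] := casimir_map_has_coef two_neq0 H_En A_Cl cA_canonical bcas.
  exists BA; split=> //; exists mu, eta; apply/(casimir_formulaP two_neq0 H_En) => //.
  by split=> //; apply: casimir_map1 bcas.
case=> BA [BBA [mu [eta /(casimir_formulaP two_neq0 H_En)[BAE b1 bE rec]]]].
exists BA => //; apply/componentP; split=> //.
exact: (casimir_map_of_coef two_neq0 H_En A_Cl cA_canonical rank1 bE).
Qed.
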